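(* For an integer $d\ge 1$, write $48(d-1)=31d_0+d_1$ with integers $d_0,d_1$, where $0\le d_1<31$. Then $d_0$ is the degree of the Hilbert series of $R_{3,8,d}$ and the leading coefficient is the coefficient of $t^{d_1}$ in \[\left[\frac{\left(1-t^{\,1+31(d-1)-20d_0}\right)^8}{(1-t)^3}\right],\] which equals the binomial coefficient $\binom{d_1+2}{2}$ when $d_0\ge 17d_1$, which in particular holds for all $d>300$.
   Context: Let $\Bbbk$ be a field of characteristic zero. $R_{3,8,d}=\Bbbk[x_1,x_2,x_3]/(\ell_1^d,\ldots,\ell_8^d)$, where $\ell_1,\ldots,\ell_8$ are general linear forms, i.e. the statement holds for all $(\ell_1,\dots,\ell_8)$ in some nonempty Zariski open subset of the space of $8$-tuples of linear forms. The Hilbert series of a standard graded algebra $A$ is $\sum_i\dim_\Bbbk(A_i)t^i$; here it is a polynomial, and its leading coefficient is the coefficient in its top degree. The brackets mean truncation at the first non-positive term: $[\sum_i c_it^i]=\sum_{i<i_0}c_it^i$ with $i_0$ the least index such that $c_{i_0}\le 0$ (no truncation if there is none). *)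

(* Defs.v *)
From HB Require Import structures.
From mathcomp Require Import all_boot all_order all_algebra.
From mathcomp Require Import mpoly.

Set Implicit Arguments.
Unset Strict Implicit.
Unset Printing Implicit Defensive.

Import GRing.Theory Num.Theory.

Local Open Scope ring_scope.

Section Algebra.

Variable k : fieldType.

Definition in_ideal n r (g : 'I_r -> {mpoly k[n]}) (p : {mpoly k[n]}) : Prop :=
  exists c : 'I_r -> {mpoly k[n]}, p = \sum_j c j * g j.

(* The degree-i piece of k[x_1, ..., x_n] / I, i.e. the image of the forms of
   degree i, has a basis with h elements (the classes of the b j). *)
Definition quotient_dim n (I : {mpoly k[n]} -> Prop) (i h : nat) : Prop :=
  exists b : 'I_h -> {mpoly k[n]},
    (forall j, b j \is i.-homog) /\
    (forall p : {mpoly k[n]}, p \is i.-homog ->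
       exists! c : 'rV[k]_h, I (p - \sum_j c ord0 j *: b j)).

Definition is_hilbert_series n (I : {mpoly k[n]} -> Prop) (H : {poly int}) :
    Prop :=
  forall i : nat, exists2 h : nat, quotient_dim I i h & H`_i = h%:Z.

(* Row j of the coefficient matrix a gives the j-th linear form. *)
Definition linear_form r n (a : 'M[k]_(r, n)) (j : 'I_r) : {mpoly k[n]} :=
  \sum_(m < n) a j m *: 'X_m.

Definition power_ideal r n (a : 'M[k]_(r, n)) (d : nat) :
    {mpoly k[n]} -> Prop :=
  in_ideal (fun j : 'I_r => linear_form a j ^+ d).

Definition zariski_open r n (U : 'M[k]_(r, n) -> Prop) : Prop :=
  exists F : {mpoly k[r * n]} -> Prop,
    forall a, U a <-> exists2 f, F f & f.@[fun s => mxvec a ord0 s] != 0.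

(* P holds for a general r-tuple of linear forms in n variables. *)
Definition for_general r n (P : 'M[k]_(r, n) -> Prop) : Prop :=
  exists U : 'M[k]_(r, n) -> Prop,
    [/\ zariski_open U, exists a, U a & forall a, U a -> P a].

End Algebra.

(* Power series expansion of p / q for q with constant term 1, by long division:
   p = q * \sum_(i < m) c_i 'X^i + 'X^m * (quotient_rem p q m) and c_m is the
   constant term of quotient_rem p q m (see quotient_seriesP). *)
Fixpoint quotient_rem (p q : {poly int}) (m : nat) : {poly int} :=
  if m is m'.+1 then
    let r := quotient_rem p q m' in drop_poly 1 (r - r`_0 *: q)
  else p.

Definition quotient_series (p q : {poly int}) (m : nat) : int :=
  (quotient_rem p q m)`_0.

Lemma quotient_remP (p q : {poly int}) (m : nat) : q`_0 = 1 ->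
  p = q * \poly_(i < m) quotient_series p q i + 'X^m * quotient_rem p q m.
Proof.
move=> q0; elim: m => [|m {1}->] /=.
  by rewrite poly_def big_ord0 mulr0 add0r expr0 mul1r.
rewrite !poly_def big_ord_recr /= mulrDr -addrA; congr (_ + _).
set r := quotient_rem p q m; set s := r - _.
have s0 : take_poly 1 s = 0.
  apply/polyP => -[|i]; rewrite coef_take_poly coef0 //=.
  by rewrite coefB coefZ q0 mulr1 subrr.
have : s = drop_poly 1 s * 'X by rewrite -[LHS](poly_take_drop 1) s0 add0r expr1.
rewrite exprSr -mulrA ['X * _]mulrC => <-.
by rewrite -scalerAr mulrBr -scalerAr [q * _]mulrC addrC subrK.
Qed.

Lemma quotient_seriesP (p q : {poly int}) (m : nat) : q`_0 = 1 ->
  \sum_(i < m.+1) q`_i * quotient_series p q (m - i)%N = p`_m.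
Proof.
move=> q0; rewrite [in RHS](quotient_remP p m.+1 q0) coefD coefXnM ltnSn addr0.
rewrite coefM; apply: eq_bigr => i _.
by rewrite coef_poly ltnS leq_subr.
Qed.

(* Coefficient m of the series with coefficients c, truncated at its first
   non-positive term. *)
Definition truncated (c : nat -> int) (m : nat) : int :=
  if [forall i : 'I_m.+1, 0 < c i] then c m else 0.

(* Main.v *)
(* Idea. By apolarity the degree i part of R is dual to the space of plane curves
   of degree i with multiplicity m = i + 1 - d at the eight points. The Bertini
   involution of the plane blown up at these points sends the class (i; m^8) to
   (17 i - 48 m; (6 i - 17 m)^8), which for i = d0 has degree d1 and for
   i = d0 + 1 has negative degree.

   Lower bound, for all points: if 6 i >= 17 m one counts conditions; otherwise
   one multiplies the curves of class (17 d1; (6 d1)^8), counted in the same way,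
   by powers of the eight sextics with one triple and seven double points.

   Upper bound, by semicontinuity for one choice of points: take points with
   integer parameters on the cuspidal cubic y z^2 = x^3 and factor the involution
   into eight quadratic transformations preserving the cubic. What remains are
   classes (i; m^8) with i >= 3 m, and these are bounded by repeatedly restricting
   to the cubic and dividing by its equation. *)

Require Import Defs.
From HB Require Import structures.
From mathcomp Require Import all_boot all_order all_algebra.
From mathcomp Require Import mpoly.
From mathcomp Require Import zify ring.

Set Implicit Arguments.
Unset Strict Implicit.
Unset Printing Implicit Defensive.

Import GRing.Theory Num.Theory.

Local Open Scope ring_scope.

(** * Taylor expansion and multiplicities *)

(** In degree i the multiplicity is m = i + 1 - d, so raising i by 1 changes 17 i - 48 m by -31.
    Hence 48 (d - 1) = 31 d0 + d1 says that the image degree is d1 at i = d0 and d1 - 31 < 0 at i =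
    d0 + 1. At i = d0 the image multiplicity is m' = 17 (d - 1) - 11 d0. The exponent in the series
    is D = d1 + 1 - m', so the coefficient of t^d1 is the expected dimension of the curves of degree
    d1 with eight points of multiplicity m'. Since 48 m' = 17 d1 - d0, these conditions disappear
    once d0 >= 17 d1.

    The cuspidal cubic is chosen because its smooth points form the additive group. A quadratic
    transformation preserving it acts on the parameters by an affine rule, so in characteristic zero
    general position along the whole chain becomes a finite computation with integers. The cubic
    passes through the eight points at every stage, and can therefore serve again in the final
    restriction argument. *)

Lemma mpoly_ring_ind (R : nzRingType) n (P : {mpoly R[n]} -> Prop) :
  (forall c, P c%:MP) -> (forall i, P 'X_i) ->
  (forall p q, P p -> P q -> P (p + q)) ->
  (forall p q, P p -> P q -> P (p * q)) -> forall p, P p.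
Proof.
move=> PC PX PD PM p; rewrite [p]mpolyE.
apply: big_ind => [||m _]; [by rewrite -mpolyC0 | exact: (PD) |].
rewrite -mul_mpolyC; apply: (PM) => //; rewrite mpolyXE_id.
apply: big_ind => [||i _]; [by rewrite -mpolyC1 | exact: (PM) |].
elim: (m i) => [|e IH]; first by rewrite expr0 -mpolyC1.
by rewrite exprS; apply: (PM).
Qed.

Lemma mpoly_rmorph_ext (R : nzRingType) n (S : nzRingType)
    (f g : {rmorphism {mpoly R[n]} -> S}) :
  (forall c, f c%:MP = g c%:MP) -> (forall i, f 'X_i = g 'X_i) -> f =1 g.
Proof.
move=> fgC fgX; elim/mpoly_ring_ind => // p q fgp fgq.
  by rewrite !rmorphD fgp fgq.
by rewrite !rmorphM fgp fgq.
Qed.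

Lemma mpoly_derivation_ext (R : nzRingType) n (S : nzRingType)
    (E : {rmorphism {mpoly R[n]} -> S}) (D : {mpoly R[n]} -> {mpoly R[n]})
    (D' : S -> S) :
  {morph D : x y / x + y} -> {morph D' : x y / x + y} ->
  (forall x y, D (x * y) = D x * y + x * D y) ->
  (forall x y, D' (x * y) = D' x * y + x * D' y) ->
  (forall c, D' (E c%:MP) = E (D c%:MP)) ->
  (forall i, D' (E 'X_i) = E (D 'X_i)) -> forall p, D' (E p) = E (D p).
Proof.
move=> DD D'D DM D'M HC HX; elim/mpoly_ring_ind => // p q Hp Hq.
  by rewrite DD !rmorphD D'D Hp Hq.
by rewrite DM rmorphM D'M rmorphD !rmorphM Hp Hq.
Qed.

(* Restates [dhomogP] without the coercion of [mdeg] to a measure. *)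
Lemma homog_mdegP (R : nzRingType) n d (p : {mpoly R[n]}) :
  reflect (forall m, p@_m != 0 -> mdeg m = d) (p \is d.-homog).
Proof.
apply: (iffP idP) => [/dhomogP H m|H].
  by rewrite -mcoeff_msupp => /H.
by apply/dhomogP => m; rewrite mcoeff_msupp => /H.
Qed.

Section Derivation.
Variables (k : fieldType) (n : nat).
Implicit Types (P : 'I_n -> k) (F G : {mpoly k[n]}).

Definition dirder P F : {mpoly k[n]} := \sum_j P j *: F^`M(j).

Lemma dirder_is_linear P : linear (dirder P).
Proof.
move=> c F G; rewrite /dirder scaler_sumr -big_split /=.
by apply: eq_bigr => j _; rewrite linearP scalerDr !scalerA mulrC.
Qed.

HB.instance Definition _ P :=
  GRing.isLinear.Build k {mpoly k[n]} {mpoly k[n]} _ (dirder P)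
    (dirder_is_linear P).

Lemma dirderC P c : dirder P c%:MP = 0.
Proof. by rewrite /dirder big1 // => j _; rewrite mderivC scaler0. Qed.

Lemma dirderU P j : dirder P 'X_j = (P j)%:MP.
Proof.
rewrite /dirder (bigD1 j) //= mderivX mnm1E eqxx.
rewrite big1 ?addr0 => [|i ij]; last first.
  by rewrite mderivX mnm1E eq_sym (negPf ij) scale0r scaler0.
suff -> : (U_(j) - U_(j))%MM = 0%MM :> 'X_{1..n}.
  by rewrite mpolyX0 scale1r -alg_mpolyC.
by apply/mnmP => i; rewrite mnmBE subnn mnm0E.
Qed.

Lemma dirderM P F G : dirder P (F * G) = dirder P F * G + F * dirder P G.
Proof.
rewrite /dirder mulr_suml mulr_sumr -big_split /=; apply: eq_bigr => j _.
by rewrite mderivM scalerDr -scalerAl -scalerAr.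
Qed.

Lemma dirder_homog P F i : F \is i.+1.-homog -> dirder P F \is i.-homog.
Proof.
move=> /homog_mdegP Fh; apply: rpred_sum => j _; apply: rpredZ.
apply/homog_mdegP => m; rewrite mcoeff_deriv => nz.
have /Fh : F@_(m + U_(j))%MM != 0.
  by apply: contraNneq nz => ->; rewrite mul0rn.
by rewrite mdegD mdeg1 addn1 => -[].
Qed.

Lemma dirder_homog0 P F : F \is 0.-homog -> dirder P F = 0.
Proof.
move=> /homog_mdegP Fh; rewrite (_ : F = (F@_0%MM)%:MP) ?dirderC //.
apply/mpolyP => m; rewrite mcoeffC; case: eqP => [->|/eqP m0].
  by rewrite mulr1.
rewrite mulr0; apply: contraNeq m0 => /Fh /eqP.
by rewrite mdeg_eq0.
Qed.

Lemma iter_dirder_homog P F i e : F \is i.-homog ->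
  iter e (dirder P) F \is (i - e).-homog.
Proof.
move=> Fh; elim: e => [|e IH]; first by rewrite subn0.
rewrite iterS; case: (leqP i e) => ie.
  have /eqP e0 : (i - e == 0)%N by [].
  by rewrite e0 in IH; rewrite dirder_homog0 // rpred0.
by apply: dirder_homog; rewrite -subSn.
Qed.

Lemma iter_dirder_eq0 P F i e : F \is i.-homog -> (i < e)%N ->
  iter e (dirder P) F = 0.
Proof.
case: e => // e Fh ie; rewrite iterS dirder_homog0 //.
by have := iter_dirder_homog P e Fh; rewrite (eqP (_ : i - e == 0)%N).
Qed.

Lemma iter_dirder_ge P F e1 e2 : (e1 <= e2)%N ->
  iter e1 (dirder P) F = 0 -> iter e2 (dirder P) F = 0.
Proof.
move=> /subnK <-; rewrite iterD => ->.
by elim: (e2 - e1)%N => //= e ->; rewrite linear0.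
Qed.

Lemma iter_dirder_sum P (I : finType) (c : I -> k) (F : I -> {mpoly k[n]}) e :
  iter e (dirder P) (\sum_l c l *: F l) =
  \sum_l c l *: iter e (dirder P) (F l).
Proof.
elim: e => //= e ->; rewrite linear_sum; apply: eq_bigr => l _.
by rewrite linearZ.
Qed.

(* The substitution F |-> F(X + s P), with s the polynomial indeterminate. *)
Definition shift P : {mpoly k[n]} -> {poly {mpoly k[n]}} :=
  mmap (polyC \o @mpolyC n k) (fun j => ('X_j)%:P + (P j)%:MP *: 'X).

HB.instance Definition _ P := GRing.RMorphism.on (shift P).

Lemma shiftC P c : shift P c%:MP = (c%:MP)%:P.
Proof. by rewrite /shift mmapC. Qed.

Lemma shiftU P j : shift P 'X_j = ('X_j)%:P + (P j)%:MP *: 'X.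
Proof. by rewrite /shift mmapX mmap1U. Qed.

(** The chain rule: differentiating F(X + s P) in s gives (D_P F)(X + s P). *)
Lemma deriv_shift P F : (shift P F)^`() = shift P (dirder P F).
Proof.
apply: (mpoly_derivation_ext (E := shift P) (D := dirder P)
  (D' := @deriv _)) => [x y|x y|x y|x y|c|j] /=.
- exact: (linearD (dirder P)).
- exact: derivD.
- exact: dirderM.
- exact: derivM.
- by rewrite shiftC derivC dirderC (rmorph0 (shift P)).
- by rewrite dirderU shiftU shiftC derivD derivC derivZ derivX add0r alg_polyC.
Qed.

Lemma shift0 P F : (shift P F)`_0 = F.
Proof.
have : ([the {rmorphism {poly {mpoly k[n]}} -> {mpoly k[n]}} of
  horner_eval (0 : {mpoly k[n]})] \o shift P) =1 idfun.
  apply: mpoly_rmorph_ext => [c|i] /=; rewrite /horner_eval.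
    by rewrite shiftC hornerC.
  by rewrite shiftU !hornerE.
by move=> /(_ F) /=; rewrite /horner_eval horner_coef0.
Qed.

Lemma coef_shift P F e : (shift P F)`_e *+ e`! = iter e (dirder P) F.
Proof.
elim: e F => [|e IH] F; first by rewrite shift0.
rewrite factS mulrnA iterSr -IH -deriv_shift.
by rewrite coef_deriv.
Qed.

Hypothesis k0 : [pchar k] =i pred0.

Lemma natf0 m : (m%:R == 0 :> k) = (m == 0)%N.
Proof. by have /pcharf0P -> := k0. Qed.

Lemma coef_shiftE P F e :
  (shift P F)`_e = (e`!%:R)^-1 *: iter e (dirder P) F.
Proof.
rewrite -coef_shift -scaler_nat scalerA mulVf ?scale1r //.
by rewrite natf0 -lt0n fact_gt0.
Qed.

Lemma taylor (S : comNzRingType) (h : {rmorphism k -> S}) P (w : 'I_n -> S)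
    (a : S) F i : F \is i.-homog ->
  mmap h (fun j => w j + h (P j) * a) F =
  \sum_(e < i.+1) a ^+ e * mmap h w ((e`!%:R)^-1 *: iter e (dirder P) F).
Proof.
move=> Fh.
have E : mmap h (fun j => w j + h (P j) * a) F =
    (map_poly (mmap h w) (shift P F)).[a].
  have := @mpoly_rmorph_ext _ _ _
    [the {rmorphism _ -> _} of mmap h (fun j => w j + h (P j) * a)]
    ([the {rmorphism {poly S} -> S} of horner_eval a] \o
      ([the {rmorphism _ -> _} of map_poly (mmap h w)] \o shift P)).
  move=> /(_ _ _ F); apply=> [c|j] /=; rewrite /horner_eval.
    by rewrite shiftC mmapC /= map_polyC hornerC /= mmapC.
  rewrite shiftU !mmapX !mmap1U rmorphD /= map_polyC /= mmapX mmap1U.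
  by rewrite linearZ /= map_polyX mmapC !hornerE.
rewrite E (@horner_coef_wide _ i.+1).
  apply: eq_bigr => e _; rewrite coef_map coef_shiftE mulrC; congr (_ * _).
apply: leq_trans (size_poly _ _) _; apply/leq_sizeP => e ie.
by rewrite coef_shiftE (iter_dirder_eq0 _ Fh) ?scaler0.
Qed.

Lemma mmap_scale (S : comNzRingType) (h : {rmorphism k -> S}) (w : 'I_n -> S)
    (s : S) F i : F \is i.-homog ->
  mmap h (fun j => s * w j) F = s ^+ i * mmap h w F.
Proof.
move=> /homog_mdegP Fh; rewrite /mmap mulr_sumr; apply: eq_big_seq => m.
rewrite mcoeff_msupp => /Fh mi.
rewrite /mmap1 mulrCA; congr (_ * _).
rewrite (eq_bigr (fun j => s ^+ m j * w j ^+ m j)) => [|j _]; last first.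
  by rewrite exprMn.
by rewrite big_split /= -expr_sum; congr (_ ^+ _ * _); rewrite -mdegE.
Qed.

End Derivation.

(** * Divisibility by prime elements of a domain *)

Definition divides (R : comNzRingType) (s x : R) := exists y, x = s * y.

Section Divides.
Variable R : idomainType.
Implicit Types s x y u : R.

Definition prime_elt s := forall x y,
  divides s (x * y) -> divides s x \/ divides s y.

Lemma prime_expl s u x m : prime_elt s -> ~ divides s u ->
  divides (s ^+ m) (u * x) -> divides (s ^+ m) x.
Proof.
move=> sP su; elim: m x => [|m IH] x; first by exists x; rewrite expr0 mul1r.
move=> [y Ey].
have /sP[/su//|[x' Ex]] : divides s (u * x).
  by exists (s ^+ m * y); rewrite mulrA -exprS.
have [s0|s0] := eqVneq s 0; first by exists 0; rewrite Ex s0 mul0r mulr0.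
have /IH[z Ez] : divides (s ^+ m) (u * x').
  exists y; apply: (mulfI s0); rewrite mulrCA -Ex Ey exprS.
  by rewrite mulrA.
by exists z; rewrite Ex Ez exprS mulrA.
Qed.

Lemma prime_exp_ndivides s u e : prime_elt s -> ~ divides s 1 ->
  ~ divides s u -> ~ divides s (u ^+ e).
Proof.
move=> sP s1 su; elim: e => [|e IH]; first by rewrite expr0.
by rewrite exprS => /sP[].
Qed.

Lemma prime_mul_ndivides s u v : prime_elt s ->
  ~ divides s u -> ~ divides s v -> ~ divides s (u * v).
Proof. by move=> sP su sv /sP[]. Qed.

(* [s] generates the kernel of the retraction [f] onto a subring of a domain. *)
Lemma prime_retract s (f : {rmorphism R -> R}) :
  f s = 0 -> (forall x, divides s (x - f x)) ->
  (forall x, divides s x <-> f x = 0) /\ prime_elt s.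
Proof.
move=> fs fP.
have H x : divides s x <-> f x = 0.
  split=> [[y ->]|fx]; first by rewrite rmorphM fs mul0r.
  by have := fP x; rewrite fx subr0.
split=> // x y /H; rewrite rmorphM => /eqP; rewrite mulf_eq0.
by case/orP=> /eqP/H; [left | right].
Qed.

End Divides.

Lemma dividesX (R : idomainType) (p : {poly R}) : divides 'X p <-> p`_0 = 0.
Proof.
split=> [[q ->]|p0]; first by rewrite mulrC coefMX.
exists (drop_poly 1 p); rewrite mulrC -[LHS](poly_take_drop 1) expr1.
suff -> : take_poly 1 p = 0 by rewrite add0r.
by apply/polyP => -[|i]; rewrite coef_take_poly coef0.
Qed.

Lemma dividesXD (R : idomainType) (p : {poly R}) c :
  divides 'X ('X * p + c%:P) -> c = 0.
Proof. by move/dividesX; rewrite coefD coefXM coefC add0r. Qed.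

Lemma primeX (R : idomainType) : prime_elt ('X : {poly R}).
Proof.
move=> p q /dividesX; rewrite coef0M => /eqP; rewrite mulf_eq0.
by case/orP=> /eqP /dividesX; [left | right].
Qed.

Lemma dividesXn (R : idomainType) (p : {poly R}) m :
  divides 'X^m p <-> forall i, (i < m)%N -> p`_i = 0.
Proof.
split=> [[q ->] i im|p0]; first by rewrite coefXnM im.
exists (drop_poly m p); rewrite mulrC -[LHS](poly_take_drop m).
suff -> : take_poly m p = 0 by rewrite add0r.
by apply/polyP => i; rewrite coef_take_poly coef0; case: ltnP => // /p0.
Qed.

Lemma divides_sumX (R : idomainType) (c : nat -> R) i m :
  divides 'X^m (\sum_(e < i.+1) 'X^(i - e) * (c e)%:P) ->
  forall e, (e <= i)%N -> (i - e < m)%N -> c e = 0.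
Proof.
move=> /dividesXn H e ei im; have := H _ im.
rewrite coef_sum (bigD1 (Ordinal (ei : (e < i.+1)%N))) //=.
rewrite coefMC coefXn eqxx mul1r big1 ?addr0 // => f fe.
rewrite coefMC coefXn; case: eqP => [ie|_]; last by rewrite mul0r.
by case/eqP: fe; apply: val_inj => /=; have := ltn_ord f; lia.
Qed.

Section Multiplicity.
Variables (k : fieldType) (n : nat).
Hypothesis k0 : [pchar k] =i pred0.
Implicit Types (P : 'I_n -> k) (F G : {mpoly k[n]}).

(* For a form F of degree i this says that F vanishes to order m at P: by
   Taylor's formula, F(P + s X) is the sum of the terms
   s^(i - e) (D_P^e F)(X) / e!. *)
Definition mult P (i m : nat) F := iter (i.+1 - m) (dirder P) F = 0.

Lemma mult_le P i m m' F : (m' <= m)%N -> mult P i m F -> mult P i m' F.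
Proof. by move=> mm; apply: iter_dirder_ge; apply: leq_sub2l. Qed.

Lemma mult0 P i F : F \is i.-homog -> mult P i 0 F.
Proof. by move=> Fh; apply: (iter_dirder_eq0 _ Fh); rewrite subn0. Qed.

Lemma mult_zero P i m : mult P i m 0.
Proof. by rewrite /mult; elim: (_ - _)%N => //= e ->; rewrite linear0. Qed.

(** The generality in [S] and [s] covers three uses: the expansion at a point ([s] an
    indeterminate), the contraction of a line ([s] its equation) and the restriction to the cubic
    ([s] the difference of two parameters). *)
Lemma mult_divides (S : comNzRingType) (h : {rmorphism k -> S}) P
    (w : 'I_n -> S) (a s : S) F i m :
  F \is i.-homog -> mult P i m F ->
  divides (s ^+ m) (mmap h (fun j => s * w j + h (P j) * a) F).
Proof.
move=> Fh Fm; rewrite (taylor k0 _ _ _ _ Fh).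
apply: big_ind => [|x y [x' ->] [y' ->]|e _]; first by exists 0; rewrite mulr0.
  by exists (x' + y'); rewrite mulrDr.
have [em|em] := leqP (i.+1 - m) e.
  by exists 0; rewrite (iter_dirder_ge em Fm) scaler0 mmap0 !mulr0.
(* The Taylor terms that may survive have e <= i - m; each is a form of degree i - e >= m evaluated
   at multiples of [s]. *)
have Dh : (e`!%:R)^-1 *: iter e (dirder P) F \is (i - e).-homog.
  by apply: rpredZ; apply: iter_dirder_homog.
rewrite (mmap_scale _ _ _ Dh).
rewrite mulrCA -(subnK (_ : m <= i - e)%N); last by lia.
by rewrite exprD -mulrA mulrCA; eexists.
Qed.

(* The substitution F |-> F(P + s X), with s the polynomial indeterminate. *)
Definition expand P : {mpoly k[n]} -> {poly {mpoly k[n]}} :=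
  mmap (polyC \o @mpolyC n k) (fun j => 'X * ('X_j)%:P + (P j)%:MP%:P * 1).

HB.instance Definition _ P := GRing.RMorphism.on (expand P).

(** Turns multiplicity into divisibility by a power of the prime ['X], where products and
    cancellation of factors are easy to handle. *)
Lemma multP P i m F : F \is i.-homog ->
  mult P i m F <-> divides 'X^m (expand P F).
Proof.
move=> Fh; split=> [Fm|]; first exact: (mult_divides _ _ _ _ Fh Fm).
(* For m = 0 the derivative of order i + 1 lies beyond the terms of the Taylor sum. *)
have [->|m0] := posnP m; first by move=> _; apply: mult0.
rewrite /expand (taylor k0 _ _ _ _ Fh).
have E e : mmap (polyC \o @mpolyC n k) (fun j => 'X * ('X_j)%:P)
     ((e`!%:R)^-1 *: iter e (dirder P) F) =
   'X^(i - e) * ((e`!%:R)^-1 *: iter e (dirder P) F)%:P.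
  have Dh : (e`!%:R)^-1 *: iter e (dirder P) F \is (i - e).-homog.
    by apply: rpredZ; apply: iter_dirder_homog.
  rewrite (mmap_scale _ _ _ Dh); congr (_ * _).
  have := @mpoly_rmorph_ext _ _ _
    [the {rmorphism {mpoly k[n]} -> {poly {mpoly k[n]}}} of
      mmap (polyC \o @mpolyC n k) (fun j => ('X_j)%:P)]
    [the {rmorphism {mpoly k[n]} -> {poly {mpoly k[n]}}} of polyC].
  by apply=> [c|j] /=; rewrite ?mmapC // mmapX mmap1U.
under eq_bigr => e _ do rewrite expr1n mul1r E.
move/(divides_sumX (c := fun e => (e`!%:R)^-1 *: iter e (dirder P) F)).
move=> /(_ (i.+1 - m)%N); set D := iter _ _ _.
rewrite /= => H; have {H} /eqP : ((i.+1 - m)`!%:R)^-1 *: D = 0 by apply: H; lia.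
rewrite scaler_eq0 invr_eq0 natf0 // -leqn0 leqNgt fact_gt0 /= => /eqP.
exact.
Qed.

Lemma multM P i j m l F G : F \is i.-homog -> G \is j.-homog ->
  mult P i m F -> mult P j l G -> mult P (i + j) (m + l) (F * G).
Proof.
move=> Fh Gh /(multP P m Fh)[x Ex] /(multP P l Gh)[y Ey].
apply/multP; first exact: dhomogM.
exists (x * y); rewrite (rmorphM (expand P)) [X in X * _]Ex [X in _ * X]Ey.
by rewrite exprD mulrACA.
Qed.

Lemma multX P i m e F : F \is i.-homog -> mult P i m F ->
  mult P (i * e) (m * e) (F ^+ e).
Proof.
move=> Fh Fm; elim: e => [|e IH].
  by rewrite !muln0 expr0; apply: mult0; apply: dhomog1.
by rewrite !mulnS exprS; apply: multM => //; apply: dhomogMn.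
Qed.

End Multiplicity.

(** * Quadratic transformations *)

Definition vec3 (S : nmodType) (x y z : S) : 'I_3 -> S :=
  fun j => nth 0 [:: x; y; z] j.

Lemma ord3_ind (P : 'I_3 -> Prop) : P ord0 -> P (inord 1) -> P (inord 2) ->
  forall j, P j.
Proof.
move=> P0 P1 P2 [[|[|[|//]]] lt_j].
- by rewrite (_ : Ordinal lt_j = ord0) //; apply: val_inj.
- by rewrite (_ : Ordinal lt_j = inord 1) //; apply: val_inj; rewrite /= inordK.
- by rewrite (_ : Ordinal lt_j = inord 2) //; apply: val_inj; rewrite /= inordK.
Qed.

Lemma vec3E0 (S : nmodType) (x y z : S) : vec3 x y z ord0 = x.
Proof. by []. Qed.
Lemma vec3E1 (S : nmodType) (x y z : S) : vec3 x y z (inord 1) = y.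
Proof. by rewrite /vec3 inordK. Qed.
Lemma vec3E2 (S : nmodType) (x y z : S) : vec3 x y z (inord 2) = z.
Proof. by rewrite /vec3 inordK. Qed.
Definition vec3E := (vec3E0, vec3E1, vec3E2).

(* The smooth point with parameter t of the cuspidal cubic y z^2 = x^3. Three of
   these points are collinear if and only if their parameters add up to 0. *)
Definition pt (S : nzRingType) (t : S) : 'I_3 -> S := vec3 t (t ^+ 3) 1.

Section CremonaFormulas.
Variable S : comNzRingType.
Implicit Types a b c tau t s x y z : S.

(* The quadratic transformation with base points a, b and third a b tau (in terms
   of parameters) whose restriction to the cubic is t |-> t + tau. Its components
   are the conics that restrict to 1, t + tau and (t + tau)^3 times cubic_at. *)
Definition third a b tau := tau *+ 3 - a - b.

Definition crem_z a b tau x y z : S :=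
  let c := third a b tau in
  y * z - tau *+ 3 * x ^+ 2 + (a * b + a * c + b * c) * (x * z)
    - a * b * c * z ^+ 2.

Definition crem_x a b tau x y z : S :=
  let c := third a b tau in
  x * y - tau *+ 3 * (y * z) + (a * b + a * c + b * c) * x ^+ 2
    - a * b * c * (x * z) + tau * crem_z a b tau x y z.

(** Conics restrict to polynomials in t of degree at most 6 without term of degree 5. The polynomial
    (t + tau)^3 (t - a) (t - b) (t - c) has this form exactly because a + b + c = 3 tau, which is
    what determines [third]. *)
Definition crem_y a b tau x y z : S :=
  let c := third a b tau in
  let e2 := a * b + a * c + b * c in let e3 := a * b * c in
  y ^+ 2 + (e2 - tau ^+ 2 *+ 6) * (x * y)
    + (tau * e2 *+ 3 - tau ^+ 3 *+ 8 - e3) * (y * z)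
    + (tau ^+ 2 * e2 *+ 3 - tau ^+ 4 *+ 3 - tau * e3 *+ 3) * x ^+ 2
    + (tau ^+ 3 * e2 - tau ^+ 2 * e3 *+ 3) * (x * z) - tau ^+ 3 * e3 * z ^+ 2.

(** The line through the points with parameters a and b; on the cubic it restricts to (t - a) (t -
    b) (t + a + b). *)
Definition chord a b x y z : S :=
  y - ((a ^+ 2 + a * b + b ^+ 2) * x - a * b * (a + b) * z).

(** The chord through b and c is contracted to the point with parameter a - 2 tau: it meets the
    cubic a third time at -b - c = a - 3 tau, which is translated by tau. *)
Lemma crem_x_contract a b tau x y z : let c := third a b tau in
  crem_x a b tau x y z =
  chord b c x y z * (x - a * z) + (a - tau *+ 2) * crem_z a b tau x y z.
Proof. by rewrite /crem_x /crem_z /chord /third; ring. Qed.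

Lemma crem_y_contract a b tau x y z : let c := third a b tau in
  let k := tau ^+ 2 + tau * (a - tau *+ 2) + (a - tau *+ 2) ^+ 2 in
  crem_y a b tau x y z =
  chord b c x y z * (y + (k - a ^+ 2) * x - a * k * z) +
  (a - tau *+ 2) ^+ 3 * crem_z a b tau x y z.
Proof. by rewrite /crem_y /crem_z /chord /third; ring. Qed.

Lemma chord_expand a b t s x y z :
  chord a b (s * x + t) (s * y + t ^+ 3) (s * z + 1) =
  s * chord a b x y z + (t - a) * (t - b) * (t + a + b).
Proof. by rewrite /chord; ring. Qed.

Definition cubic_at a b tau t := (t - a) * (t - b) * (t - third a b tau).

(** Polarization of a quadratic form q: q(s v + p) = s (q(v + p) - q(p) + (s - 1) q(v)) + q(p),
    where q(p) is known from the restriction to the cubic. *)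
Lemma crem_z_expand a b tau t s x y z :
  crem_z a b tau (s * x + t) (s * y + t ^+ 3) (s * z + 1) =
  s * (crem_z a b tau (x + t) (y + t ^+ 3) (z + 1) - cubic_at a b tau t
       + (s - 1) * crem_z a b tau x y z)
  + cubic_at a b tau t.
Proof. by rewrite /crem_z /cubic_at /third; ring. Qed.

Lemma crem_x_expand a b tau t s x y z :
  crem_x a b tau (s * x + t) (s * y + t ^+ 3) (s * z + 1) =
  s * (crem_x a b tau (x + t) (y + t ^+ 3) (z + 1)
       - (t + tau) * cubic_at a b tau t + (s - 1) * crem_x a b tau x y z)
  + (t + tau) * cubic_at a b tau t.
Proof. by rewrite /crem_x /crem_z /cubic_at /third; ring. Qed.

Lemma crem_y_expand a b tau t s x y z :
  crem_y a b tau (s * x + t) (s * y + t ^+ 3) (s * z + 1) =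
  s * (crem_y a b tau (x + t) (y + t ^+ 3) (z + 1)
       - (t + tau) ^+ 3 * cubic_at a b tau t + (s - 1) * crem_y a b tau x y z)
  + (t + tau) ^+ 3 * cubic_at a b tau t.
Proof. by rewrite /crem_y /cubic_at /third; ring. Qed.

Definition chords a b tau x y z := let c := third a b tau in
  chord b c x y z * (chord a c x y z * chord a b x y z).

Section Inverse.
Variables a b tau x y z : S.
Let x' := crem_x a b tau x y z.
Let y' := crem_y a b tau x y z.
Let z' := crem_z a b tau x y z.

(** The inverse transformation translates by -tau and has as base points the three points to which
    chords are contracted. The composite is the identity up to the product of the contracted
    lines. *)
Lemma crem_x_inv : crem_x (a - tau *+ 2) (b - tau *+ 2) (- tau) x' y' z' =
  chords a b tau x y z * x.
Proof.
rewrite /x' /y' /z' /chords /crem_x /crem_y /crem_z /chord /third.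
ring.
Qed.

Lemma crem_y_inv : crem_y (a - tau *+ 2) (b - tau *+ 2) (- tau) x' y' z' =
  chords a b tau x y z * y.
Proof.
rewrite /x' /y' /z' /chords /crem_x /crem_y /crem_z /chord /third.
ring.
Qed.

Lemma crem_z_inv : crem_z (a - tau *+ 2) (b - tau *+ 2) (- tau) x' y' z' =
  chords a b tau x y z * z.
Proof.
rewrite /x' /y' /z' /chords /crem_x /crem_y /crem_z /chord /third.
ring.
Qed.

End Inverse.
End CremonaFormulas.

Lemma rmorph_mmap (R S T : comNzRingType) n (f : {rmorphism S -> T})
    (h : {rmorphism R -> S}) (w : 'I_n -> S) (F : {mpoly R[n]}) :
  f (mmap h w F) = mmap (f \o h) (f \o w) F.
Proof.
rewrite /mmap rmorph_sum; apply: eq_bigr => m _; rewrite rmorphM; congr (_ * _).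
by rewrite /mmap1 rmorph_prod; apply: eq_bigr => j _; rewrite rmorphXn.
Qed.

Lemma mmap_eq (R S : nzRingType) n (h h' : R -> S) (w w' : 'I_n -> S)
    (F : {mpoly R[n]}) :
  h =1 h' -> w =1 w' -> mmap h w F = mmap h' w' F.
Proof.
move=> hh ww; apply: eq_bigr => m _; rewrite hh; congr (_ * _).
by apply: eq_bigr => j _; rewrite ww.
Qed.

Lemma mmap_id (R : comNzRingType) n (F : {mpoly R[n]}) :
  mmap (@mpolyC n R) (fun j => 'X_j) F = F.
Proof.
have := @mpoly_rmorph_ext _ _ _
  [the {rmorphism {mpoly R[n]} -> {mpoly R[n]}} of
    mmap (@mpolyC n R) (fun j => 'X_j)]
  [the {rmorphism {mpoly R[n]} -> {mpoly R[n]}} of idfun].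
by apply=> [c|j] /=; rewrite ?mmapC // mmapX mmap1U.
Qed.

Lemma homog_U (R : nzRingType) n (j : 'I_n) :
  'X_j \is [in R[n], 1.-homog].
Proof. by rewrite dhomogX /= mdeg1. Qed.

Section Homogeneous.
Variables (R : idomainType) (n : nat).
Implicit Types (U G : {mpoly R[n]}).

Lemma mcoeff_pihomog d G m :
  (pihomog mdeg d G)@_m = if mdeg m == d then G@_m else 0.
Proof.
rewrite pihomogE raddf_sum big_mkcond /=.
have [Gm|Gm] := boolP (m \in msupp G); last first.
  rewrite big1_seq => [|m' /andP[_ m'G]].
    by move: Gm; rewrite mcoeff_msupp negbK => /eqP ->; rewrite if_same.
  case: ifP => // _; rewrite mcoeffZ mcoeffX.
  case: eqP => [E|]; last by rewrite mulr0.
  by rewrite -E m'G in Gm.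
rewrite (bigD1_seq m) ?msupp_uniq //= mcoeffZ mcoeffX eqxx mulr1.
rewrite big1 ?addr0 // => m' m'm; case: ifP => // _.
by rewrite mcoeffZ mcoeffX (negPf m'm) mulr0.
Qed.

Lemma pihomogM U u G e : U \is u.-homog ->
  pihomog mdeg (u + e) (U * G) = U * pihomog mdeg e G.
Proof.
move=> Uh; rewrite [G in LHS]mpolyE [G in RHS]mpolyE mulr_sumr !linear_sum /=.
rewrite mulr_sumr; apply: eq_bigr => m _.
rewrite -scalerAr [LHS]linearZ [X in U * X]linearZ -scalerAr /=.
rewrite pihomogX; congr (_ *: _).
have Xh : U * 'X_[m] \is (u + mdeg m).-homog.
  by apply: dhomogM; rewrite ?dhomogX.
case: ifP => [/eqP <-|me]; first by rewrite pihomog_dE.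
rewrite mulr0 (pihomog_ne0 _ Xh) //.
by apply: contraFneq me => /addnI E; apply/eqP; apply: E.
Qed.

(** Multiplication by a form U commutes with taking graded components up to a shift, so a component
    of G in a wrong degree would be killed by U. *)
Lemma homog_factor U u G N : U != 0 -> U \is u.-homog -> G != 0 ->
  U * G \is N.-homog -> (u <= N)%N /\ G \is (N - u).-homog.
Proof.
move=> U0 Uh G0 UGh.
have H m : G@_m != 0 -> N = (u + mdeg m)%N.
  move=> Gm; apply/eqP; apply: contraNT Gm => Nm.
  have := pihomogM G (mdeg m) Uh.
  rewrite (pihomog_ne0 _ UGh) ?[(u + _)%N == _]eq_sym //.
  move=> /esym/eqP; rewrite mulf_eq0 (negPf U0) /= => /eqP E.
  by have := mcoeff_pihomog (mdeg m) G m; rewrite E mcoeff0 eqxx => <-.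
split; last by apply/homog_mdegP => m /H ->; rewrite addKn.
have : G@_(mlead G) != 0 by rewrite mleadc_eq0.
by move=> /H ->; rewrite leq_addr.
Qed.

Lemma mmap_homog S (q : 'I_n -> {mpoly R[S]}) d F e :
  (forall j, q j \is d.-homog) -> F \is e.-homog ->
  mmap (@mpolyC S R) q F \is (d * e).-homog.
Proof.
move=> qh /homog_mdegP Fh; rewrite /mmap big_seq; apply: rpred_sum => m.
rewrite mcoeff_msupp => /Fh <-; rewrite mul_mpolyC; apply: rpredZ.
rewrite /mmap1 mdegE big_distrr /=.
apply: (big_ind2 (fun p e => p \is e.-homog)) => [|p1 e1 p2 e2|j _].
- exact: dhomog1.
- exact: dhomogM.
- exact: dhomogMn.
Qed.

End Homogeneous.

Section CremonaMorphism.
Variables (S T : comNzRingType) (f : {rmorphism S -> T}).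
Implicit Types a b tau x y z : S.

Lemma chord_rmorph a b x y z :
  f (chord a b x y z) = chord (f a) (f b) (f x) (f y) (f z).
Proof. by rewrite /chord !(rmorphB, rmorphD, rmorphM, rmorphXn). Qed.

Lemma chord_rmorph_eq a b x y z (a' b' x' y' z' : T) :
  f a = a' -> f b = b' -> f x = x' -> f y = y' -> f z = z' ->
  f (chord a b x y z) = chord a' b' x' y' z'.
Proof. by rewrite chord_rmorph => -> -> -> -> ->. Qed.

Lemma crem_z_rmorph a b tau x y z :
  f (crem_z a b tau x y z) = crem_z (f a) (f b) (f tau) (f x) (f y) (f z).
Proof.
by rewrite /crem_z /third !(rmorphB, rmorphD, rmorphM, rmorphXn, rmorphMn).
Qed.

Lemma crem_x_rmorph a b tau x y z :
  f (crem_x a b tau x y z) = crem_x (f a) (f b) (f tau) (f x) (f y) (f z).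
Proof.
rewrite /crem_x /third.
by rewrite !(rmorphB, rmorphD, rmorphM, rmorphXn, rmorphMn, crem_z_rmorph).
Qed.

Lemma crem_y_rmorph a b tau x y z :
  f (crem_y a b tau x y z) = crem_y (f a) (f b) (f tau) (f x) (f y) (f z).
Proof.
rewrite /crem_y /third; set e2 := a * b + _ + _; set e3 := a * b * _.
have Ee3 : f e3 = f a * f b * (f tau *+ 3 - f a - f b).
  by rewrite /e3 !rmorphM !rmorphB rmorphMn.
have Ee2 : f e2 = f a * f b + f a * (f tau *+ 3 - f a - f b) +
    f b * (f tau *+ 3 - f a - f b).
  by rewrite /e2 !rmorphD !rmorphM !rmorphB rmorphMn.
rewrite -Ee2 -Ee3; move: e2 e3 {Ee2 Ee3} => e2 e3.
rewrite rmorphB !rmorphD !rmorphM !rmorphB !rmorphMn !rmorphM.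
by [].
Qed.

End CremonaMorphism.

Definition cremona (S : comNzRingType) (a b tau x y z : S) : 'I_3 -> S :=
  vec3 (crem_x a b tau x y z) (crem_y a b tau x y z) (crem_z a b tau x y z).

Lemma cremona_rmorph (S T : comNzRingType) (f : {rmorphism S -> T})
    (a b tau x y z : S) :
  f \o cremona a b tau x y z =1 cremona (f a) (f b) (f tau) (f x) (f y) (f z).
Proof.
apply: ord3_ind; rewrite /cremona /= !vec3E.
- exact: crem_x_rmorph.
- exact: crem_y_rmorph.
- exact: crem_z_rmorph.
Qed.

Lemma cremona_rmorph_eq (S T : comNzRingType) (f : {rmorphism S -> T})
    (a b tau x y z : S) (a' b' tau' x' y' z' : T) :
  f a = a' -> f b = b' -> f tau = tau' -> f x = x' -> f y = y' -> f z = z' ->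
  forall j, f (cremona a b tau x y z j) = cremona a' b' tau' x' y' z' j.
Proof. by move=> <- <- <- <- <- <-; apply: cremona_rmorph. Qed.

Lemma cremona_sym (S : comNzRingType) (a b tau x y z : S) :
  cremona a b tau x y z =1 cremona b a tau x y z.
Proof.
apply: ord3_ind; rewrite /cremona !vec3E /crem_x /crem_y /crem_z /third; ring.
Qed.

(** Together with [cremona_sym] this permutes the base points, so that facts about one of them or
    about one chord carry over to the others. *)
Lemma cremona_third (S : comNzRingType) (a b tau x y z : S) :
  cremona a b tau x y z =1 cremona (third a b tau) b tau x y z.
Proof.
apply: ord3_ind; rewrite /cremona !vec3E /crem_x /crem_y /crem_z /third; ring.
Qed.

Section CremonaPoly.
Variable k : fieldType.
Hypothesis k0 : [pchar k] =i pred0.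
Implicit Types (a b c tau t : k) (F G : {mpoly k[3]}).

Local Notation R := {mpoly k[3]}.
Local Notation X0 := ('X_(ord0 : 'I_3) : R).
Local Notation X1 := ('X_(inord 1 : 'I_3) : R).
Local Notation X2 := ('X_(inord 2 : 'I_3) : R).

Definition chordP a b : R := chord a%:MP b%:MP X0 X1 X2.

Definition cremonaP a b tau : 'I_3 -> R :=
  cremona a%:MP b%:MP tau%:MP X0 X1 X2.

Definition pullback a b tau : R -> R := mmap (@mpolyC 3 k) (cremonaP a b tau).

HB.instance Definition _ a b tau := GRing.RMorphism.on (pullback a b tau).

Lemma chordPC a b : chordP a b = chordP b a.
Proof. by rewrite /chordP /chord; ring. Qed.

Lemma thirdP a b tau : (third a b tau)%:MP = third a%:MP b%:MP tau%:MP :> R.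
Proof. by rewrite /third !mpolyCB mpolyCMn. Qed.

Lemma mmap_congr (q q' : 'I_3 -> R) (s : R) F :
  (forall j, divides s (q j - q' j)) ->
  divides s (mmap (@mpolyC 3 k) q F - mmap (@mpolyC 3 k) q' F).
Proof.
move=> H.
elim/mpoly_ring_ind: F => [c|j|p p' [x Ex] [x' Ex']|p p' [x Ex] [x' Ex']].
- by rewrite !mmapC subrr; exists 0; rewrite mulr0.
- by rewrite !mmapX !mmap1U.
- by rewrite !mmapD; exists (x + x'); rewrite mulrDr -Ex -Ex' opprD addrACA.
have E (u u' v v' y y' : R) : u - v = s * y -> u' - v' = s * y' ->
    u * u' - v * v' = s * (u * y' + v' * y).
  by move=> Ey Ey'; rewrite mulrDr [s * (u * _)]mulrCA [s * (v' * _)]mulrCA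
    -Ey -Ey'; ring.
eexists; have M := rmorphM (mmap (@mpolyC 3 k) q) p p'.
have M' := rmorphM (mmap (@mpolyC 3 k) q') p p'.
by etransitivity; [exact: (congr2 (fun u v => u - v) M M') | exact: E Ex Ex'].
Qed.

(** Solving the linear equation for X1 is a retraction whose kernel is generated by the chord. Two
    chords through a coincide only if b = c or the three points are collinear. *)
Lemma chordP_prime a b : prime_elt (chordP a b) /\
  forall c, b != c -> a + b + c != 0 -> ~ divides (chordP a b) (chordP a c).
Proof.
pose y := (a ^+ 2 + a * b + b ^+ 2)%:MP * X0 - (a * b * (a + b))%:MP * X2.
pose f := [the {rmorphism R -> R} of mmap (@mpolyC 3 k) (vec3 X0 y X2)].
have fC c : f c%:MP = c%:MP by rewrite /= mmapC.
have fX j : f 'X_j = vec3 X0 y X2 j by rewrite /= mmapX mmap1U.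
have f0 := fX ord0; have f1 := fX (inord 1); have f2 := fX (inord 2).
rewrite !vec3E in f0 f1 f2.
have fchord c : f (chordP a c) = chord a%:MP c%:MP X0 y X2.
  by rewrite chord_rmorph !fC f0 f1 f2.
have [||H Hp] := @prime_retract _ (chordP a b) f.
- rewrite fchord /chord /y !(mpolyCM, mpolyCD, rmorphXn) /=; ring.
- move=> F; rewrite -{1}[F]mmap_id; apply: mmap_congr.
  apply: ord3_ind; rewrite vec3E.
  + by exists 0; rewrite subrr mulr0.
  + exists 1; rewrite mulr1 /chordP /chord /y.
    rewrite !(mpolyCM, mpolyCD, rmorphXn) /=; ring.
  + by exists 0; rewrite subrr mulr0.
split=> // c bc abc /H; rewrite fchord.
move/(congr1 (mcoeff U_(ord0))).
have -> : chord a%:MP c%:MP X0 y X2 =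
    ((b - c) * (a + b + c)) *: X0 - ((b - c) * (a * (a + b + c))) *: X2.
  rewrite -!mul_mpolyC /chord /y.
  rewrite !(mpolyCM, mpolyCD, mpolyCB, rmorphXn) /=; ring.
rewrite mcoeffB !mcoeffZ !mcoeffX mcoeff0 eqxx eq_mnm1 mulr1.
rewrite -(inj_eq val_inj) /= inordK //= mulr0 subr0 => /eqP.
by rewrite mulf_eq0 subr_eq0 (negPf bc) (negPf abc).
Qed.

Lemma chordPE a b : chordP a b =
  X1 - ((a ^+ 2 + a * b + b ^+ 2) *: X0 - (a * b * (a + b)) *: X2).
Proof.
by rewrite -!mul_mpolyC /chordP /chord !(mpolyCM, mpolyCD, rmorphXn).
Qed.

Lemma homog_chordP a b : chordP a b \is 1.-homog.
Proof.
by rewrite chordPE !(rpredB, rpredZ) ?homog_U.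
Qed.

Lemma chordP_neq0 a b : chordP a b != 0.
Proof.
apply/eqP => /(congr1 (mcoeff U_(inord 1))); rewrite chordPE.
rewrite !mcoeffB !mcoeffZ !mcoeffX mcoeff0 eqxx !eq_mnm1.
rewrite -!(inj_eq val_inj) /= !inordK //= !mulr0 !subr0 => /eqP.
by rewrite oner_eq0.
Qed.

End CremonaPoly.

Section CremonaStep.
Variable k : fieldType.
Hypothesis k0 : [pchar k] =i pred0.
Implicit Types (a b c tau t : k) (F G : {mpoly k[3]}).

Local Notation R := {mpoly k[3]}.
Local Notation X0 := ('X_(ord0 : 'I_3) : R).
Local Notation X1 := ('X_(inord 1 : 'I_3) : R).
Local Notation X2 := ('X_(inord 2 : 'I_3) : R).
Local Notation Rc := ({mpoly k[3]} : comNzRingType).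
Local Notation Sc := ({poly {mpoly k[3]}} : comNzRingType).
Local Notation C2 := (polyC \o @mpolyC 3 k).

Lemma expandC P (c : k) : expand P (c%:MP : R) = c%:MP%:P.
Proof. by rewrite /expand mmapC. Qed.

Lemma expandU P (j : 'I_3) :
  expand P ('X_j : R) = 'X * ('X_j)%:P + (P j)%:MP%:P :> {poly R}.
Proof. by rewrite /expand mmapX mmap1U mulr1. Qed.

Lemma expand_pt t : let E := expand (pt t) in
  [/\ E X0 = 'X * X0%:P + t%:MP%:P, E X1 = 'X * X1%:P + t%:MP%:P ^+ 3 &
      E X2 = 'X * X2%:P + 1].
Proof.
rewrite /= !expandU /pt !vec3E; split=> //.
by rewrite -(rmorphXn C2).
Qed.

Lemma expand_chordP t a b : expand (pt t) (chordP a b) =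
  'X * (chordP a b)%:P + ((t - a) * (t - b) * (t + a + b))%:MP%:P.
Proof.
have [E0 E1 E2] := expand_pt t.
have EC c := expandC (pt t) c.
rewrite /chordP.
have -> : expand (pt t) (chord a%:MP b%:MP X0 X1 X2) =
    chord a%:MP%:P b%:MP%:P ('X * X0%:P + t%:MP%:P)
      ('X * X1%:P + t%:MP%:P ^+ 3) ('X * X2%:P + 1).
  apply: (@chord_rmorph_eq Rc Sc (expand (pt t))); [exact: EC | exact: EC |
    exact: E0 | exact: E1 | exact: E2].
rewrite chord_expand; congr (_ * _ + _).
  by apply/esym; apply: (@chord_rmorph_eq Rc Sc (@polyC R)).
rewrite !mpolyCM !mpolyCD !polyCM !polyCD.
by rewrite !mpolyCN !polyCN.
Qed.

Lemma expand_chordP_ndivides t a b : t != a -> t != b -> t + a + b != 0 ->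
  ~ divides 'X (expand (pt t) (chordP a b)).
Proof.
move=> ta tb tab; rewrite expand_chordP => /dividesXD/eqP.
rewrite mpolyC_eq0 !mulf_eq0 !subr_eq0.
by rewrite (negPf ta) (negPf tb) (negPf tab).
Qed.

Lemma expand_chordP_on t a b : (t - a) * (t - b) * (t + a + b) = 0 ->
  expand (pt t) (chordP a b) = 'X * (chordP a b)%:P.
Proof. by rewrite expand_chordP => ->; rewrite mpolyC0 polyC0 addr0. Qed.

(** The transformation sends the point t of the cubic to t + tau, up to the factor [cubic_at], which
    vanishes exactly at the base points. *)
Lemma expand_cremonaP t a b tau : exists W : 'I_3 -> {poly R},
  expand (pt t) \o cremonaP a b tau =1
  fun j => 'X * W j + C2 (pt (t + tau) j) * C2 (cubic_at a b tau t).
Proof.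
have [E0 E1 E2] := expand_pt t.
have EC c := expandC (pt t) c.
pose A := a%:MP%:P : {poly R}; pose B := b%:MP%:P : {poly R}.
pose Tau := tau%:MP%:P : {poly R}; pose t2 := t%:MP%:P : {poly R}.
have E j : expand (pt t) (cremonaP a b tau j) = cremona A B Tau
    ('X * X0%:P + t2) ('X * X1%:P + t2 ^+ 3) ('X * X2%:P + 1) j.
  apply: (@cremona_rmorph_eq Rc Sc (expand (pt t)));
    [exact: EC | exact: EC | exact: EC | exact: E0 | exact: E1 | exact: E2].
have Ec : C2 (cubic_at a b tau t) = cubic_at A B Tau t2.
  rewrite /cubic_at /third.
  by rewrite /= !mpolyCM !mpolyCB mpolyCMn !polyCM !polyCB polyCMn.
pose Wx := crem_x A B Tau (X0%:P + t2) (X1%:P + t2 ^+ 3) (X2%:P + 1)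
  - (t2 + Tau) * cubic_at A B Tau t2
  + ('X - 1) * crem_x A B Tau X0%:P X1%:P X2%:P.
pose Wy := crem_y A B Tau (X0%:P + t2) (X1%:P + t2 ^+ 3) (X2%:P + 1)
  - (t2 + Tau) ^+ 3 * cubic_at A B Tau t2
  + ('X - 1) * crem_y A B Tau X0%:P X1%:P X2%:P.
pose Wz := crem_z A B Tau (X0%:P + t2) (X1%:P + t2 ^+ 3) (X2%:P + 1)
  - cubic_at A B Tau t2
  + ('X - 1) * crem_z A B Tau X0%:P X1%:P X2%:P.
exists (vec3 Wx Wy Wz); apply: ord3_ind.
- rewrite [LHS]E /cremona vec3E crem_x_expand Ec.
  by rewrite /pt !vec3E (rmorphD C2).
- rewrite [LHS]E /cremona vec3E crem_y_expand Ec.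
  by rewrite /pt !vec3E (rmorphXn C2) (rmorphD C2).
- rewrite [LHS]E /cremona vec3E crem_z_expand Ec.
  by rewrite /pt !vec3E (rmorph1 C2) mul1r.
Qed.

Lemma pullback_mult t a b tau F i m : F \is i.-homog ->
  mult (pt (t + tau)) i m F ->
  divides 'X^m (expand (pt t) (pullback a b tau F)).
Proof.
move=> Fh Fm; have [W EW] := expand_cremonaP t a b tau.
rewrite /pullback [X in divides _ X](@rmorph_mmap k Rc Sc _ (expand (pt t))).
rewrite (@mmap_eq _ _ _ _ C2 _ _ _ _ EW); last by move=> c; apply: expandC.
exact: (mult_divides k0 C2 W _ 'X Fh Fm).
Qed.

(** At a base point all three component conics vanish, so a form of degree i in them vanishes to
    order i. *)
Lemma pullback_mult_base t a b tau F i : F \is i.-homog ->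
  cubic_at a b tau t = 0 ->
  divides 'X^i (expand (pt t) (pullback a b tau F)).
Proof.
move=> Fh ct; have [W EW] := expand_cremonaP t a b tau.
rewrite /pullback [X in divides _ X](@rmorph_mmap k Rc Sc _ (expand (pt t))).
rewrite (@mmap_eq _ _ _ _ C2 _ (fun j => 'X * W j)).
- by rewrite (mmap_scale C2 W 'X Fh); eexists.
- by move=> c; apply: expandC.
by move=> j; rewrite [LHS]EW ct (rmorph0 C2) mulr0 addr0.
Qed.

(** Modulo the chord the component conics are the coordinates of the point a - 2 tau times
    [crem_z]. *)
Lemma pullback_contract a b tau F i m : F \is i.-homog ->
  mult (pt (a - tau *+ 2)) i m F ->
  divides (chordP b (third a b tau) ^+ m) (pullback a b tau F).
Proof.
move=> Fh Fm; rewrite /pullback.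
pose A : R := a%:MP; pose Tau : R := tau%:MP.
pose K := Tau ^+ 2 + Tau * (A - Tau *+ 2) + (A - Tau *+ 2) ^+ 2.
have EA : (a - tau *+ 2)%:MP = A - Tau *+ 2 by rewrite mpolyCB mpolyCMn.
pose w := vec3 (X0 - A * X2) (X1 + (K - A ^+ 2) * X0 - A * K * X2) 0.
rewrite (@mmap_eq _ _ _ _ (@mpolyC 3 k) _ (fun j =>
    chordP b (third a b tau) * w j +
    (pt (a - tau *+ 2) j)%:MP * crem_z A b%:MP Tau X0 X1 X2)) //.
  exact: (mult_divides k0 (@mpolyC 3 k) w _ _ Fh Fm).
rewrite /cremonaP /cremona /chordP thirdP.
apply: ord3_ind; rewrite /w /pt !vec3E.
- by rewrite crem_x_contract EA.
- by rewrite crem_y_contract rmorphXn /= EA.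
- by rewrite mulr0 add0r mpolyC1 mul1r.
Qed.

Lemma pullback_sym a b tau F : pullback a b tau F = pullback b a tau F.
Proof. by apply: mmap_eq => [//|j]; apply: (@cremona_sym Rc). Qed.

Lemma pullback_third a b tau F :
  pullback a b tau F = pullback (third a b tau) b tau F.
Proof.
apply: mmap_eq => [//|j]; rewrite /cremonaP thirdP; exact: (@cremona_third Rc).
Qed.

Lemma pullbackC a b tau c : pullback a b tau c%:MP = c%:MP.
Proof. by rewrite /pullback mmapC. Qed.

Lemma pullbackU a b tau (j : 'I_3) : pullback a b tau 'X_j = cremonaP a b tau j.
Proof. by rewrite /pullback mmapX mmap1U. Qed.

Definition chordsP a b tau : R := chords a%:MP b%:MP tau%:MP X0 X1 X2.

Lemma chordsPE a b tau : let c := third a b tau in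
  chordsP a b tau = chordP b c * (chordP a c * chordP a b).
Proof. by rewrite /chordsP /chords /chordP !thirdP. Qed.

Lemma pullback_cremonaP a b tau j :
  pullback a b tau (cremonaP (a - tau *+ 2) (b - tau *+ 2) (- tau) j) =
  chordsP a b tau * 'X_j.
Proof.
have f0 := pullbackU a b tau ord0; have f1 := pullbackU a b tau (inord 1).
have f2 := pullbackU a b tau (inord 2); have fC := pullbackC a b tau.
rewrite /cremonaP /cremona !vec3E in f0 f1 f2.
have EC (c : k) : (c - tau *+ 2)%:MP = c%:MP - tau%:MP *+ 2 :> R.
  by rewrite mpolyCB mpolyCMn.
have EN : (- tau)%:MP = - tau%:MP :> R by rewrite mpolyCN.
have -> : pullback a b tau (cremonaP (a - tau *+ 2) (b - tau *+ 2) (- tau) j) =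
    cremona (a%:MP - tau%:MP *+ 2) (b%:MP - tau%:MP *+ 2) (- tau%:MP)
      (crem_x a%:MP b%:MP tau%:MP X0 X1 X2)
      (crem_y a%:MP b%:MP tau%:MP X0 X1 X2)
      (crem_z a%:MP b%:MP tau%:MP X0 X1 X2) j.
  apply: (@cremona_rmorph_eq Rc Rc (pullback a b tau));
    [by rewrite [LHS]fC EC | by rewrite [LHS]fC EC | by rewrite [LHS]fC EN |
     exact: f0 | exact: f1 | exact: f2].
move: j; apply: ord3_ind; rewrite /cremona vec3E.
- exact: (@crem_x_inv Rc).
- exact: (@crem_y_inv Rc).
- exact: (@crem_z_inv Rc).
Qed.

Lemma chordsP_neq0 a b tau : chordsP a b tau != 0.
Proof. by rewrite chordsPE !mulf_neq0 ?chordP_neq0. Qed.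

(** Pulling back once more, by the inverse transformation, multiplies F by a power of the nonzero
    product of three chords. *)
Lemma pullback_eq0 a b tau F i : F \is i.-homog ->
  pullback a b tau F = 0 -> F = 0.
Proof.
move=> Fh F0; pose a' := a - tau *+ 2; pose b' := b - tau *+ 2.
have : pullback a' b' (- tau) (pullback a b tau F) = 0.
  by rewrite F0 (rmorph0 (pullback _ _ _)).
rewrite {2}/pullback.
rewrite [X in X = 0](@rmorph_mmap k Rc Rc _ (pullback a' b' (- tau))).
rewrite (@mmap_eq _ _ _ _ (@mpolyC 3 k) _
  (fun j => chordsP a' b' (- tau) * 'X_j)).
- rewrite (mmap_scale (@mpolyC 3 k) _ _ Fh) => /eqP; rewrite mulf_eq0.
  rewrite expf_eq0 (negPf (chordsP_neq0 _ _ _)) andbF /= => /eqP.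
  by rewrite mmap_id.
- exact: pullbackC.
have Ea : a' - (- tau) *+ 2 = a by rewrite /a' mulNrn opprK subrK.
have Eb : b' - (- tau) *+ 2 = b by rewrite /b' mulNrn opprK subrK.
move=> j; have := pullback_cremonaP a' b' (- tau) j.
by rewrite Ea Eb opprK.
Qed.

End CremonaStep.

Lemma rmorph_monomial3 (S T : comNzRingType) (f : {rmorphism S -> T})
    (u v w g : S) (u' v' w' g' : T) l m n :
  f u = u' -> f v = v' -> f w = w' -> f g = g' ->
  f (u ^+ l * (v ^+ m * w ^+ n) * g) = u' ^+ l * (v' ^+ m * w' ^+ n) * g'.
Proof. by move=> <- <- <- <-; rewrite !rmorphM !rmorphXn. Qed.

Section DividesMonomial.
Variable A : idomainType.
Implicit Types (s x y z u v w : A).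

Lemma divides_cancel3 s u v w x l m n e : prime_elt s -> ~ divides s 1 ->
  ~ divides s u -> ~ divides s v -> ~ divides s w ->
  divides (s ^+ e) (u ^+ l * (v ^+ m * w ^+ n) * x) -> divides (s ^+ e) x.
Proof.
move=> sP s1 su sv sw; apply: prime_expl => //.
by do !apply: prime_mul_ndivides => //; apply: prime_exp_ndivides.
Qed.

Lemma divides_factor3 u v w x l m n :
  prime_elt u -> prime_elt v -> prime_elt w ->
  ~ divides u 1 -> ~ divides v 1 -> ~ divides w 1 ->
  ~ divides v u -> ~ divides w u -> ~ divides w v ->
  divides (u ^+ l) x -> divides (v ^+ m) x -> divides (w ^+ n) x ->
  exists y, x = u ^+ l * (v ^+ m * w ^+ n) * y.
Proof.
move=> uP vP wP u1 v1 w1 vu wu wv [y Ey]; rewrite Ey.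
move/(prime_expl vP (prime_exp_ndivides vP v1 vu)) => [z Ez]; rewrite Ez.
move/(prime_expl wP (prime_exp_ndivides wP w1 wu)).
move/(prime_expl wP (prime_exp_ndivides wP w1 wv)) => [t ->].
by exists t; rewrite -!mulrA.
Qed.

End DividesMonomial.

(** The local count at a base point: the two chords through it vanish there to first order and the
    third does not vanish. Removing the powers m and n of the two lowers the order i by m + n; a
    negative result is cut to 0, that is, to no condition. *)
Lemma dividesX_base (A : idomainType) (U g : {poly A}) (v w : A) l m n i :
  ~ divides 'X U ->
  v != 0 -> w != 0 ->
  divides 'X^i (U ^+ l * (('X * v%:P) ^+ m * ('X * w%:P) ^+ n) * g) ->
  divides 'X^(i - (m + n)) g.
Proof.
have X1 : ~ divides ('X : {poly A}) 1.
  by move=> /dividesX /eqP; rewrite coef1 oner_eq0.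
have XC (c : A) : c != 0 -> ~ divides 'X c%:P.
  by move=> c0 /dividesX /eqP; rewrite coefC (negPf c0).
move=> XU v0 w0.
have -> : U ^+ l * (('X * v%:P) ^+ m * ('X * w%:P) ^+ n) * g =
    U ^+ l * (v%:P ^+ m * w%:P ^+ n) * ('X^(m + n) * g).
  rewrite !exprMn exprD; move: ('X^m) ('X^n) (v%:P ^+ m) (w%:P ^+ n) (U ^+ l).
  by move=> a b c d e; ring.
move/(divides_cancel3 (@primeX A) X1 XU (XC _ v0) (XC _ w0)).
have [imn|imn] := leqP i (m + n).
  by rewrite (eqP imn) => _; exists g; rewrite mul1r.
case=> y Ey; exists y; apply: (@mulfI _ 'X^(m + n)).
  by rewrite expf_neq0 // polyX_eq0.
by rewrite Ey mulrA -exprD subnKC // ltnW.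
Qed.

Definition general_triple (V : zmodType) (a b c : V) :=
  [&& a != b, a != c, b != c & a + b + c != 0].

(** The point t lies on none of the three chords, since the chord through a and b meets the cubic at
    a, b and -a - b. An arbitrary group is allowed in order to test this over the integers and
    transport it to the field. *)
Definition general_wrt (V : zmodType) (a b c t : V) :=
  [&& t != a, t != b, t != c, t + a + b != 0, t + a + c != 0 & t + b + c != 0].

Section CremonaStep.
Variable k : fieldType.
Hypothesis k0 : [pchar k] =i pred0.
Implicit Types (a b c tau t : k) (F G : {mpoly k[3]}).

Local Notation R := {mpoly k[3]}.
Local Notation Rc := ({mpoly k[3]} : comNzRingType).
Local Notation Sc := ({poly {mpoly k[3]}} : comNzRingType).

Definition linsys (s : seq (k * nat)) i F :=
  F \is i.-homog /\ forall p, p \in s -> mult (pt p.1) i p.2 F.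

(* Dimension bounds for subspaces given by predicates: L has no linearly
   independent family with more than N members. *)
Definition dimle n (L : {mpoly k[n]} -> Prop) N :=
  forall r (F : 'I_r -> {mpoly k[n]}), (forall j, L (F j)) -> (N < r)%N ->
  exists2 c : 'rV[k]_r, c != 0 & \sum_j c 0 j *: F j = 0.

Lemma expand1_ndivides : ~ divides ('X : {poly R}) 1.
Proof. by move=> /dividesX /eqP; rewrite coef1 oner_eq0. Qed.

Lemma chordP1_ndivides a b : ~ divides (chordP a b) 1.
Proof.
case=> y E1; have y0 : y != 0.
  by apply/eqP => y0; move: E1; rewrite y0 mulr0 => /eqP; rewrite oner_eq0.
have [] := homog_factor (N := 0) (chordP_neq0 a b) (homog_chordP a b) y0.
  by rewrite -E1 dhomog1.
by [].
Qed.

Local Notation X0 := ('X_(ord0 : 'I_3) : R).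
Local Notation X1 := ('X_(inord 1 : 'I_3) : R).
Local Notation X2 := ('X_(inord 2 : 'I_3) : R).

Lemma homog_quadric (c1 c2 c3 c4 c5 c6 : k) (j1 j2 j3 : 'I_3) :
  c1%:MP * ('X_j1 * 'X_j2) + c2%:MP * ('X_j2 * 'X_j3) + c3%:MP * 'X_j1 ^+ 2
    + c4%:MP * ('X_j1 * 'X_j3) + c5%:MP * 'X_j3 ^+ 2 + c6%:MP * 'X_j2 ^+ 2
  \is [in k[3], 2.-homog].
Proof.
have XXh (i j : 'I_3) : 'X_i * 'X_j \is [in k[3], 2.-homog].
  by apply: (dhomogM (homog_U _ _) (homog_U _ _)).
by rewrite !expr2 !mul_mpolyC !rpredD ?rpredZ ?XXh.
Qed.

Lemma homog_crem_z a b tau :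
  crem_z a%:MP b%:MP tau%:MP X0 X1 X2 \is [in k[3], 2.-homog].
Proof.
rewrite /crem_z -thirdP; move: (third a b tau) => c; set z := (X in X \is _).
have -> : z =
  0%:MP * (X0 * X1) + 1%:MP * (X1 * X2) + (- (tau *+ 3))%:MP * X0 ^+ 2
  + (a * b + a * c + b * c)%:MP * (X0 * X2) + (- (a * b * c))%:MP * X2 ^+ 2
  + 0%:MP * X1 ^+ 2.
  rewrite {}/z mpolyC0 mpolyC1.
  rewrite !(mpolyCD, mpolyCM, mpolyCN, mpolyCMn).
  by move: a%:MP b%:MP c%:MP tau%:MP X0 X1 X2 => A B C T x y w; ring.
exact: homog_quadric.
Qed.

Lemma homog_crem_x a b tau :
  crem_x a%:MP b%:MP tau%:MP X0 X1 X2 \is [in k[3], 2.-homog].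
Proof.
rewrite /crem_x; have := homog_crem_z a b tau.
move: (crem_z _ _ _ _ _ _) => cz czh.
rewrite -thirdP; move: (third a b tau) => c; set z := (X in X \is _).
have -> : z = 1%:MP * (X0 * X1) + (- (tau *+ 3))%:MP * (X1 * X2)
  + (a * b + a * c + b * c)%:MP * X0 ^+ 2
  + (- (a * b * c))%:MP * (X0 * X2) + 0%:MP * X2 ^+ 2
  + 0%:MP * X1 ^+ 2 + tau%:MP * cz.
  rewrite {}/z mpolyC0 mpolyC1.
  rewrite !(mpolyCD, mpolyCM, mpolyCN, mpolyCMn).
  by move: a%:MP b%:MP c%:MP tau%:MP X0 X1 X2 => A B C T x y w; ring.
apply: rpredD; first exact: homog_quadric.
by rewrite mul_mpolyC rpredZ.
Qed.

Lemma homog_crem_y a b tau :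
  crem_y a%:MP b%:MP tau%:MP X0 X1 X2 \is [in k[3], 2.-homog].
Proof.
rewrite /crem_y -thirdP; move: (third a b tau) => c; set z := (X in X \is _).
pose e2 := a * b + a * c + b * c; pose e3 := a * b * c.
have -> : z = (e2 - tau ^+ 2 *+ 6)%:MP * (X0 * X1)
  + (tau * e2 *+ 3 - tau ^+ 3 *+ 8 - e3)%:MP * (X1 * X2)
  + (tau ^+ 2 * e2 *+ 3 - tau ^+ 4 *+ 3 - tau * e3 *+ 3)%:MP * X0 ^+ 2
  + (tau ^+ 3 * e2 - tau ^+ 2 * e3 *+ 3)%:MP * (X0 * X2)
  + (- (tau ^+ 3 * e3))%:MP * X2 ^+ 2 + 1%:MP * X1 ^+ 2.
  have E2 : e2%:MP = a%:MP * b%:MP + a%:MP * c%:MP + b%:MP * c%:MP :> R.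
    by rewrite !mpolyCD !mpolyCM.
  have E3 : e3%:MP = a%:MP * b%:MP * c%:MP :> R by rewrite !mpolyCM.
  rewrite /z -E2 -E3 mpolyC1 {E2 E3}; move: (e2) (e3) => f2 f3.
  have X n : (tau ^+ n)%:MP = tau%:MP ^+ n :> R by rewrite rmorphXn.
  rewrite !(mpolyCD, mpolyCM, mpolyCN, mpolyCMn, X).
  by move: f2%:MP f3%:MP tau%:MP X0 X1 X2 => A B T x y w; ring.
exact: homog_quadric.
Qed.

Lemma cremona_base a b tau F G i e l m n : let c := third a b tau in
  F \is i.-homog -> G \is e.-homog ->
  pullback a b tau F =
    chordP b c ^+ l * (chordP a c ^+ m * chordP a b ^+ n) * G ->
  a != b -> a != c -> a + b + c != 0 -> mult (pt a) e (i - (m + n)) G.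
Proof.
move=> c Fh Gh E ab ac abc; apply/(multP k0) => //.
have ca : cubic_at a b tau a = 0 by rewrite /cubic_at subrr !mul0r.
have := pullback_mult_base Fh ca; rewrite E.
have -> := @rmorph_monomial3 Rc Sc (expand (pt a)) _ _ _ _ _ _ _ _ l m n
  (erefl (expand (pt a) (chordP b c)))
  (expand_chordP_on (_ : (a - a) * (a - c) * (a + a + c) = 0))
  (expand_chordP_on (_ : (a - a) * (a - b) * (a + a + b) = 0)) (erefl _).
- by move/dividesX_base; apply=> //; rewrite ?chordP_neq0 //;
    apply: expand_chordP_ndivides.
- by rewrite subrr !mul0r.
- by rewrite subrr !mul0r.
Qed.

(* Each chord through two base points is contracted to a point at which F has the
   prescribed multiplicity, so its equation divides the pullback of F as often. *)
Lemma cremona_step a b tau (l m n : nat) (s : seq (k * nat)) i F :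
  let c := third a b tau in
  general_triple a b c -> all (fun p => general_wrt a b c p.1) s ->
  linsys [:: (a - tau *+ 2, l), (b - tau *+ 2, m), (c - tau *+ 2, n) &
          [seq (p.1 + tau, p.2) | p <- s]] i F -> F != 0 ->
  exists G, [/\ pullback a b tau F =
      chordP b c ^+ l * (chordP a c ^+ m * chordP a b ^+ n) * G,
    (l + m + n <= 2 * i)%N &
    linsys [:: (a, i - (m + n))%N, (b, i - (l + n))%N, (c, i - (l + m))%N & s]
      (2 * i - (l + m + n)) G].
Proof.
move=> c /and4P[ab ac bc abc] gens [Fh Fm] F0.
have tc1 : third b a tau = c by rewrite /third /c /third addrAC.
have tc2 : third c b tau = a by rewrite /third /c /third; ring.
have Fa : mult (pt (a - tau *+ 2)) i l F.
  by apply: (Fm (a - tau *+ 2, l)); rewrite !inE eqxx.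
have Fb : mult (pt (b - tau *+ 2)) i m F.
  by apply: (Fm (b - tau *+ 2, m)); rewrite !inE eqxx !orbT.
have Fc : mult (pt (c - tau *+ 2)) i n F.
  by apply: (Fm (c - tau *+ 2, n)); rewrite !inE eqxx !orbT.
have {Fa} Fa := pullback_contract k0 b Fh Fa.
have {Fb} := pullback_contract k0 a Fh Fb; rewrite tc1 -pullback_sym => Fb.
have {Fc} := pullback_contract k0 b Fh Fc.
rewrite tc2 -pullback_third chordPC => Fc.
have [G EG] : exists G, pullback a b tau F =
    chordP b c ^+ l * (chordP a c ^+ m * chordP a b ^+ n) * G.
  apply: divides_factor3 => //; try exact: chordP1_ndivides;
    try exact: (chordP_prime _ _).1.
  - rewrite ![chordP _ c]chordPC; apply: (chordP_prime _ _).2 => //.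
    by rewrite -addrA addrC.
  - rewrite [chordP a b]chordPC; apply: (chordP_prime _ _).2 => //.
    by rewrite [b + a]addrC.
  - exact: (chordP_prime _ _).2.
have G0 : G != 0.
  apply: contraNneq F0 => G0; apply/eqP.
  apply: (@pullback_eq0 _ a b tau _ i) => //.
  by rewrite EG G0 mulr0.
pose u := chordP b c ^+ l * (chordP a c ^+ m * chordP a b ^+ n).
have uh : u \is (l + m + n).-homog.
  have ch (x y : k) e : chordP x y ^+ e \is e.-homog.
    by rewrite -[X in X.-homog]mul1n; apply: dhomogMn; apply: homog_chordP.
  rewrite -addnA; exact: (dhomogM (ch _ _ _) (dhomogM (ch _ _ _) (ch _ _ _))).
have u0 : u != 0 by rewrite !mulf_neq0 ?expf_neq0 ?chordP_neq0.
have pFh : pullback a b tau F \is (2 * i).-homog.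
  apply: mmap_homog Fh; apply: ord3_ind; rewrite /cremonaP /cremona vec3E.
  - exact: homog_crem_x.
  - exact: homog_crem_y.
  - exact: homog_crem_z.
(* The divisor of a nonzero form of degree 2 i has degree at most 2 i. This bound is what later
   forces systems of negative image degree to vanish. *)
have [le Gh] : (l + m + n <= 2 * i)%N /\ G \is (2 * i - (l + m + n)).-homog.
  by apply: (homog_factor u0 uh G0); rewrite -EG.
have ba : chordP b a = chordP a b := chordPC b a.
have ca : chordP c a = chordP a c := chordPC c a.
have cb : chordP c b = chordP b c := chordPC c b.
have EGb : pullback b a tau F =
    chordP a (third b a tau) ^+ m * (chordP b (third b a tau) ^+ l *
      chordP b a ^+ n) * G.
  rewrite tc1 ba; transitivity (pullback a b tau F).
    exact: pullback_sym.
  by rewrite [LHS]EG; congr (_ * _); apply: mulrCA.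
have EGc : pullback c b tau F =
    chordP b (third c b tau) ^+ n * (chordP c (third c b tau) ^+ m *
      chordP c b ^+ l) * G.
  rewrite tc2 ba ca cb; transitivity (pullback a b tau F).
    by apply/esym; apply: pullback_third.
  rewrite [LHS]EG; congr (_ * _); rewrite [LHS]mulrC -mulrA.
  exact: mulrCA.
have ma : mult (pt a) (2 * i - (l + m + n)) (i - (m + n)) G.
  exact: (cremona_base Fh Gh EG).
have mb : mult (pt b) (2 * i - (l + m + n)) (i - (l + n)) G.
  apply: (cremona_base Fh Gh EGb); first by rewrite eq_sym.
    by rewrite tc1.
  by rewrite tc1 [b + a]addrC.
have mc : mult (pt c) (2 * i - (l + m + n)) (i - (l + m)) G.
  have -> : (i - (l + m) = i - (m + l))%N by rewrite [(l + m)%N]addnC.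
  apply: (cremona_base Fh Gh EGc).
  - by rewrite eq_sym.
  - by rewrite tc2 eq_sym.
  - by rewrite tc2 addrC [c + b]addrC addrA.
exists G; split; [exact: EG | exact: le | split; [exact: Gh|]] => p.
rewrite !inE => /or4P[/eqP->|/eqP->|/eqP->|ps];
  [exact: ma | exact: mb | exact: mc |].
have /= := allP gens p ps.
case/and5P=> pa pb pc pab /andP[pac pbc].
apply/(multP k0) => //.
have Fp : mult (pt (p.1 + tau)) i p.2 F.
  apply: (Fm (p.1 + tau, p.2)).
  by rewrite !inE (map_f (fun q => (q.1 + tau, q.2)) ps) !orbT.
have := pullback_mult k0 a b Fh Fp; rewrite EG.
have -> := @rmorph_monomial3 Rc Sc (expand (pt p.1)) _ _ _ _ _ _ _ _ l m n
  (erefl _) (erefl _) (erefl _) (erefl _).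
apply: divides_cancel3; [exact: primeX | exact: expand1_ndivides | | |];
  exact: expand_chordP_ndivides.
Qed.

End CremonaStep.

(** * The Bertini involution *)

Lemma dimle_sub (k : fieldType) n (L L' : {mpoly k[n]} -> Prop) N :
  (forall F, L F -> L' F) -> dimle L' N -> dimle L N.
Proof. by move=> LL HN r F HF; apply: HN => j; apply: LL. Qed.

Lemma dimle0 (k : fieldType) n (L : {mpoly k[n]} -> Prop) :
  (forall F, L F -> F = 0) -> dimle L 0.
Proof.
move=> L0 [|r] // F LF _; exists (const_mx 1).
  by apply/eqP => /matrixP/(_ 0 0); rewrite !mxE => /eqP; rewrite oner_eq0.
by apply: big1 => j _; rewrite (L0 _ (LF j)) scaler0.
Qed.

Section Chain.
Variable k : fieldType.
Hypothesis k0 : [pchar k] =i pred0.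
Implicit Types (F G : {mpoly k[3]}).

Lemma intf0 (z : int) : (z%:~R == 0 :> k) = (z == 0).
Proof.
by case: z => z; rewrite ?NegzE ?mulrNz ?oppr_eq0 -pmulrn natf0 // eqz_nat.
Qed.

Lemma intf_inj : injective (intr : int -> k).
Proof.
by move=> x y /eqP; rewrite -subr_eq0 -rmorphB intf0 subr_eq0 => /eqP.
Qed.

(** All pullbacks share the factor [u], so a linear relation between the quotients is one between
    the pullbacks, and pullback is injective on forms. *)
Lemma dimle_cremona (a b tau : k) l m n s i N : let c := third a b tau in
  general_triple a b c -> all (fun p => general_wrt a b c p.1) s ->
  dimle (linsys [:: (a, i - (m + n))%N, (b, i - (l + n))%N,
                    (c, i - (l + m))%N & s] (2 * i - (l + m + n))) N ->
  dimle (linsys [:: (a - tau *+ 2, l), (b - tau *+ 2, m), (c - tau *+ 2, n) &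
                    [seq (p.1 + tau, p.2) | p <- s]] i) N.
Proof.
move=> c gen gens HN r F HF rN.
set L := linsys _ _ in HN.
pose u := chordP b c ^+ l * (chordP a c ^+ m * chordP a b ^+ n).
have /fin_all_exists2[G LG EG] (j : 'I_r) :
    exists2 G, L G & pullback a b tau (F j) = u * G.
  have [Fj0|Fj0] := eqVneq (F j) 0.
    exists 0; last by rewrite Fj0 mulr0 (rmorph0 (pullback _ _ _)).
    by split=> [|p _]; [apply: rpred0 | apply: mult_zero].
  by have [G [E _ LG]] := cremona_step k0 gen gens (HF j) Fj0; exists G.
have [d d0 dG] := HN r G LG rN; exists d => //.
have Fh : \sum_j d 0 j *: F j \is i.-homog.
  by apply: rpred_sum => j _; apply: rpredZ; case: (HF j).
apply: (pullback_eq0 (a := a) (b := b) (tau := tau) Fh).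
transitivity (u * \sum_j d 0 j *: G j); last by rewrite dG mulr0.
rewrite mulr_sumr.
rewrite [LHS](rmorph_sum (pullback a b tau)).
apply: eq_bigr => j _; rewrite -scalerAr -[in RHS]EG -!mul_mpolyC.
by rewrite [LHS](rmorphM (pullback a b tau)) /= pullbackC.
Qed.

Lemma linsys_cremona_eq0 (a b tau : k) (l m n : nat) (s : seq (k * nat)) i F :
  let c := third a b tau in
  general_triple a b c -> all (fun p => general_wrt a b c p.1) s ->
  linsys [:: (a - tau *+ 2, l), (b - tau *+ 2, m), (c - tau *+ 2, n) &
             [seq (p.1 + tau, p.2) | p <- s]] i F ->
  (2 * i < l + m + n)%N -> F = 0.
Proof.
move=> c gen gens LF lt; apply/eqP; apply: contraTT lt => F0.
by have [G []] := cremona_step k0 gen gens LF F0; rewrite -leqNgt.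
Qed.

(* The integer parameters make the position conditions on the points decidable
   by computation. *)
Definition isys (t : seq int) (m : seq nat) i F := F \is i.-homog /\
  forall j, (j < size t)%N -> mult (pt (t`_j)%:~R) i (nth 0%N m j) F.

(* The action of the quadratic transformation on the parameters: a reflection in
   the Weyl group of E8. *)
Definition reflection (tau : int) (a b c : nat) (t t' : seq int) :=
  [&& uniq [:: a; b; c], size t' == size t,
      [&& (a < size t)%N, (b < size t)%N & (c < size t)%N],
      t'`_a + t'`_b + t'`_c == tau *+ 3, general_triple t'`_a t'`_b t'`_c &
      all (fun j => if j \in [:: a; b; c] then t`_j == t'`_j - tau *+ 2
        else (t`_j == t'`_j + tau) && general_wrt t'`_a t'`_b t'`_c t'`_j)
      (iota 0 (size t))].

Lemma general_triple_intr (x y z : int) : general_triple x y z ->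
  general_triple (x%:~R : k) y%:~R z%:~R.
Proof.
by rewrite /general_triple -!rmorphD intf0 !(inj_eq intf_inj).
Qed.

Lemma general_wrt_intr (x y z t : int) : general_wrt x y z t ->
  general_wrt (x%:~R : k) y%:~R z%:~R t%:~R.
Proof. by rewrite /general_wrt -!rmorphD !intf0 !(inj_eq intf_inj). Qed.

Section OneStep.
Variables (tau : int) (a b c : nat) (t t' : seq int) (m : seq nat) (i : nat).
Hypothesis tt' : reflection tau a b c t t'.

Let rest : seq (k * nat) :=
  [seq ((t'`_j)%:~R, nth 0%N m j) |
    j <- iota 0 (size t) & j \notin [:: a; b; c]].

Let ta : k := (t'`_a)%:~R.
Let tb : k := (t'`_b)%:~R.
Let tc : k := (t'`_c)%:~R.

Let thirdE : third ta tb tau%:~R = tc.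
Proof.
have /and4P[_ _ _ /andP[/eqP E _]] := tt'.
by rewrite /third -rmorphMn /= -E !rmorphD /= -/ta -/tb -/tc; ring.
Qed.

Let gen : general_triple ta tb (third ta tb tau%:~R).
Proof.
have /and4P[_ _ _ /and3P[_ gen _]] := tt'.
by rewrite thirdE; apply: general_triple_intr.
Qed.

Let allt j : (j < size t)%N -> if j \in [:: a; b; c] then t`_j = t'`_j - tau *+ 2
  else t`_j = t'`_j + tau /\ general_wrt t'`_a t'`_b t'`_c t'`_j.
Proof.
have /and4P[_ _ _ /and3P[_ _ /allP H]] := tt'.
move=> jt; have := H j; rewrite mem_iota add0n jt => /(_ isT).
by case: ifP => _ => [/eqP|/andP[/eqP]].
Qed.

Let gens : all (fun p => general_wrt ta tb (third ta tb tau%:~R) p.1) rest.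
Proof.
apply/allP => p /mapP[j].
rewrite mem_filter mem_iota add0n /= => /andP[jabc jt] ->.
have := allt jt; rewrite (negPf jabc) => -[_ g].
by rewrite thirdE; apply: general_wrt_intr.
Qed.

Let sys_old F : isys t m i F ->
  linsys [:: (ta - tau%:~R *+ 2, nth 0%N m a), (tb - tau%:~R *+ 2, nth 0%N m b),
             (third ta tb tau%:~R - tau%:~R *+ 2, nth 0%N m c) &
             [seq (p.1 + tau%:~R, p.2) | p <- rest]] i F.
Proof.
have /and4P[_ _ /and3P[at_ bt ct] _] := tt'.
case=> Fh Fm; split=> // p.
have H j : j \in [:: a; b; c] -> (j < size t)%N ->
    mult (pt ((t'`_j)%:~R - tau%:~R *+ 2)) i (nth 0%N m j) F.
  move=> jabc jt; have := Fm j jt; have := allt jt; rewrite jabc => ->.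
  by rewrite rmorphB rmorphMn.
rewrite thirdE !inE => /or4P[/eqP->|/eqP->|/eqP->|/mapP[q /mapP[j]]] /=.
- by apply: H; rewrite // !inE eqxx.
- by apply: H; rewrite // !inE eqxx ?orbT.
- by apply: H; rewrite // !inE eqxx ?orbT.
rewrite mem_filter mem_iota add0n /= => /andP[jabc jt] -> -> /=.
have := Fm j jt; have := allt jt; rewrite (negPf jabc) => -[-> _].
by rewrite rmorphD.
Qed.

(** Lower multiplicities only enlarge the system, so inequalities suffice for [m']; only the degree
    must be exact. *)
Lemma dimle_reflection (m' : seq nat) (i' : nat) N :
  (nth 0 m' a <= i - (nth 0 m b + nth 0 m c))%N ->
  (nth 0 m' b <= i - (nth 0 m a + nth 0 m c))%N ->
  (nth 0 m' c <= i - (nth 0 m a + nth 0 m b))%N ->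
  (forall j, (j < size t)%N -> j \notin [:: a; b; c] ->
    (nth 0 m' j <= nth 0 m j)%N) ->
  i' = (2 * i - (nth 0 m a + nth 0 m b + nth 0 m c))%N ->
  dimle (isys t' m' i') N -> dimle (isys t m i) N.
Proof.
move=> ma mb mc mj ->{i'} HN; apply: dimle_sub sys_old _.
apply: dimle_cremona => //; apply: dimle_sub HN => G [Gh Gm]; split=> // j.
have /and4P[_ /eqP -> _ _] := tt' => jt.
have [jabc|jabc] := boolP (j \in [:: a; b; c]); last first.
  apply: (mult_le (mj j jt jabc)).
  apply: (Gm ((t'`_j)%:~R, nth 0%N m j)); rewrite !inE.
  suff -> : ((t'`_j)%:~R, nth 0%N m j) \in rest by rewrite !orbT.
  by apply: map_f; rewrite mem_filter jabc mem_iota add0n.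
have Ga := Gm _ (mem_head _ _).
have Gb : mult (pt tb) (2 * i - (nth 0%N m a + nth 0%N m b + nth 0%N m c))
    (i - (nth 0%N m a + nth 0%N m c)) G.
  apply: (Gm (tb, (i - (nth 0%N m a + nth 0%N m c))%N)).
  by rewrite !inE eqxx !orbT.
have Gc : mult (pt tc) (2 * i - (nth 0%N m a + nth 0%N m b + nth 0%N m c))
    (i - (nth 0%N m a + nth 0%N m b)) G.
  apply: (Gm (tc, (i - (nth 0%N m a + nth 0%N m b))%N)).
  by rewrite thirdE !inE eqxx !orbT.
by move: jabc; rewrite !inE => /or3P[]/eqP->;
  [exact: (mult_le ma) | exact: (mult_le mb) | exact: (mult_le mc)].
Qed.

Lemma isys_reflection_eq0 F : isys t m i F ->
  (2 * i < nth 0%N m a + nth 0%N m b + nth 0%N m c)%N -> F = 0.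
Proof. by move/sys_old/(linsys_cremona_eq0 gen gens). Qed.

End OneStep.
End Chain.


(* A configuration in sufficiently general position, found by search, and its
   images under the eight quadratic transformations. *)
Definition config (e : nat) : seq int :=
  match e with
  | 0 => [:: 14; 8; 17; 29; -1; 26; -10; 23]%Z
  | 1 => [:: -12; -18; -9; 42; 12; 39; 3; 36]%Z
  | 2 => [:: 19; 13; 22; -20; -50; -23; 34; 67]%Z
  | 3 => [:: -61; 53; 62; 20; -10; 17; -46; -13]%Z
  | 4 => [:: -16; -37; -28; -70; 35; 62; -1; 32]%Z
  | 5 => [:: 16; -5; 4; -38; -29; -2; -65; 64]%Z
  | 6 => [:: -34; -55; 29; -13; -4; 23; -40; 14]%Z
  | 7 => [:: -30; -51; 21; -21; -12; 27; -36; 18]%Z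
  | _ => [:: -8; -29; -23; 1; 10; -17; -14; -26]%Z
  end.

Lemma config_reflection0 : reflection (-13)%Z 0 1 2
  (config 0) (config 1).
Proof. by vm_compute. Qed.

Lemma config_reflection1 : reflection (-31)%Z 3 4 5
  (config 1) (config 2).
Proof. by vm_compute. Qed.

Lemma config_reflection2 : reflection (-40)%Z 6 7 0
  (config 2) (config 3).
Proof. by vm_compute. Qed.

Lemma config_reflection3 : reflection (-45)%Z 1 2 3
  (config 3) (config 4).
Proof. by vm_compute. Qed.

Lemma config_reflection4 : reflection (-32)%Z 4 5 6
  (config 4) (config 5).
Proof. by vm_compute. Qed.

Lemma config_reflection5 : reflection (-25)%Z 7 0 1
  (config 5) (config 6).
Proof. by vm_compute. Qed.

Lemma config_reflection6 : reflection (-4)%Z 2 3 4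
  (config 6) (config 7).
Proof. by vm_compute. Qed.

Lemma config_reflection7 : reflection (-22)%Z 2 5 7
  (config 7) (config 8).
Proof. by vm_compute. Qed.

Section Bertini.
Variable k : fieldType.
Hypothesis k0 : [pchar k] =i pred0.
Variables i m : nat.
Hypothesis im : (45 * m <= 16 * i)%N.

Local Ltac step H i' m' := 
  apply: (dimle_reflection k0 H (m' := m') (i' := i'));
  [ by rewrite /=; lia | by rewrite /=; lia | by rewrite /=; lia
  | by do 8! (case=> [|]; first by move=> _; rewrite !inE //=; lia)
  | by rewrite /=; lia | ].

(** The hypothesis 45 m <= 16 i keeps every degree up to 16 i - 45 m and every multiplicity except 6
    i - 17 m from being truncated. A point that has reached 6 i - 17 m is never again a base point,
    so cutting this number to 0 is harmless. The last transformation is kept apart because its image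
    degree 17 i - 48 m may be negative. *)
Lemma dimle_partial_bertini N :
  dimle (@isys k (config 7)
      [:: 6 * i - 17 * m; 6 * i - 17 * m; 5 * i - 14 * m; 6 * i - 17 * m;
      6 * i - 17 * m; 5 * i - 14 * m; 6 * i - 17 * m; 5 * i - 14 * m]%N
      (16 * i - 45 * m)%N) N ->
  dimle (@isys k (config 0) (nseq 8 m) i) N.
Proof.
move=> HN.
step config_reflection0 (2 * i - 3 * m)%N
  [:: i - 2 * m; i - 2 * m; i - 2 * m; m;
      m; m; m; m]%N.
step config_reflection1 (4 * i - 9 * m)%N
  [:: i - 2 * m; i - 2 * m; i - 2 * m; 2 * i - 5 * m;
      2 * i - 5 * m; 2 * i - 5 * m; m; m]%N.
step config_reflection2 (7 * i - 18 * m)%N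
  [:: 4 * i - 11 * m; i - 2 * m; i - 2 * m; 2 * i - 5 * m;
      2 * i - 5 * m; 2 * i - 5 * m; 3 * i - 8 * m; 3 * i - 8 * m]%N.
step config_reflection3 (10 * i - 27 * m)%N
  [:: 4 * i - 11 * m; 4 * i - 11 * m; 4 * i - 11 * m; 5 * i - 14 * m;
      2 * i - 5 * m; 2 * i - 5 * m; 3 * i - 8 * m; 3 * i - 8 * m]%N.
step config_reflection4 (13 * i - 36 * m)%N
  [:: 4 * i - 11 * m; 4 * i - 11 * m; 4 * i - 11 * m; 5 * i - 14 * m;
      5 * i - 14 * m; 5 * i - 14 * m; 6 * i - 17 * m; 3 * i - 8 * m]%N.
step config_reflection5 (15 * i - 42 * m)%N
  [:: 6 * i - 17 * m; 6 * i - 17 * m; 4 * i - 11 * m; 5 * i - 14 * m;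
      5 * i - 14 * m; 5 * i - 14 * m; 6 * i - 17 * m; 5 * i - 14 * m]%N.
step config_reflection6 (16 * i - 45 * m)%N
  [:: 6 * i - 17 * m; 6 * i - 17 * m; 5 * i - 14 * m; 6 * i - 17 * m;
      6 * i - 17 * m; 5 * i - 14 * m; 6 * i - 17 * m; 5 * i - 14 * m]%N.
exact: HN.
Qed.

(** Up to order, [config 8] is the negative of [config 0]: the Bertini involution acts as -1 on the
    E8 lattice. The order is irrelevant for equal multiplicities. *)
Lemma dimle_bertini N :
  dimle (@isys k (config 8) (nseq 8 (6 * i - 17 * m)%N)
      (17 * i - 48 * m)%N) N ->
  dimle (@isys k (config 0) (nseq 8 m) i) N.
Proof.
move=> HN; apply: dimle_partial_bertini.
step config_reflection7 (17 * i - 48 * m)%N (nseq 8 (6 * i - 17 * m)%N).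
exact: HN.
Qed.

Lemma bertini_eq0 F : (17 * i < 48 * m)%N ->
  @isys k (config 0) (nseq 8 m) i F -> F = 0.
Proof.
move=> neg LF; apply/eqP; apply: contraT => F0.
have H : dimle (@isys k (config 7)
      [:: 6 * i - 17 * m; 6 * i - 17 * m; 5 * i - 14 * m; 6 * i - 17 * m;
      6 * i - 17 * m; 5 * i - 14 * m; 6 * i - 17 * m; 5 * i - 14 * m]%N
      (16 * i - 45 * m)%N) 0.
  apply: dimle0 => G LG.
  (* Three multiplicities 5 i - 14 m at the base points exceed 2 (16 i - 45 m) exactly when 17 i <
     48 m. *)
  by apply: (isys_reflection_eq0 k0 config_reflection7 LG); rewrite /=; lia.
have [c c0] := dimle_partial_bertini H (fun _ : 'I_1 => LF) isT.
rewrite big_ord1 => /eqP; rewrite scaler_eq0 (negPf F0) orbF => c00.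
by case/eqP: c0; apply/matrixP => a b; rewrite !ord1 mxE (eqP c00).
Qed.

End Bertini.

(** * Restriction to the cuspidal cubic *)

Lemma prod_ord3 (S : comNzRingType) (f : 'I_3 -> S) :
  \prod_j f j = f ord0 * f (inord 1) * f (inord 2).
Proof.
rewrite !big_ord_recl big_ord0 mulr1 mulrA.
by congr (_ * f _ * f _); apply: val_inj; rewrite /= inordK.
Qed.

Lemma mdeg_ord3 (m : 'X_{1..3}) :
  mdeg m = (m ord0 + m (inord 1) + m (inord 2))%N.
Proof.
rewrite mdegE !big_ord_recl big_ord0 addn0 addnA.
by congr (_ + m _ + m _)%N; apply: val_inj; rewrite /= inordK.
Qed.

(* Rank-nullity for phi on L, whose kernel is g * L'. *)
Lemma dimle_fiber (k : fieldType) n (L L' : {mpoly k[n]} -> Prop) s N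
    (phi : {mpoly k[n]} -> 'rV[k]_s) (g : {mpoly k[n]}) :
  (forall r (F : 'I_r -> {mpoly k[n]}) (c : 'rV[k]_r), (forall j, L (F j)) ->
    L (\sum_j c 0 j *: F j) /\
    phi (\sum_j c 0 j *: F j) = \sum_j c 0 j *: phi (F j)) ->
  (forall F, L F -> phi F = 0 -> exists2 G, F = g * G & L' G) ->
  dimle L' N -> dimle L (N + s).
Proof.
move=> lin fib HN r F HF rN.
pose A := \matrix_(j < r) phi (F j); pose B := row_base (kermx A).
have BA l : phi (\sum_j row l B 0 j *: F j) = 0.
  rewrite (lin _ F (row l B) HF).2.
  have /sub_kermxP BA : (B <= kermx A)%MS by rewrite eq_row_base.
  transitivity (row l B *m A); last by rewrite -row_mul BA row0.
  rewrite mulmx_sum_row; apply: eq_bigr => j _; congr (_ *: _).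
  by rewrite rowK.
have HB l : exists2 G, \sum_j row l B 0 j *: F j = g * G & L' G.
  by apply: fib => //; apply: (lin _ F (row l B) HF).1.
have /fin_all_exists2[G EG LG] := HB.
have [||c c0 cG] := HN _ G => //.
  rewrite mxrank_ker; have := rank_leq_col A; lia.
exists (c *m B).
  apply: contraNneq c0 => cB; have fB : row_free B := row_base_free _.
  by apply/eqP/(row_free_inj fB); rewrite cB mul0mx.
transitivity (\sum_l c 0 l *: \sum_j row l B 0 j *: F j); last first.
  transitivity (g * \sum_l c 0 l *: G l); last by rewrite cG mulr0.
  by rewrite mulr_sumr; apply: eq_bigr => l _; rewrite EG scalerAr.
under [RHS]eq_bigr do rewrite scaler_sumr.
rewrite [RHS]exchange_big /=; apply: eq_bigr => j _.
rewrite mxE scaler_suml; apply: eq_bigr => l _.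
by rewrite scalerA; congr (_ *: _); rewrite [in RHS]mxE.
Qed.

Definition mons i : seq 'X_{1..3} :=
  [seq s2m t | t : i.-tuple 'I_3 <- enum (basis 3 i)].

Lemma mem_mons i m : (m \in mons i) = (mdeg m == i).
Proof. by rewrite basis_cover. Qed.

Lemma uniq_mons i : uniq (mons i).
Proof. exact: uniq_basis. Qed.

Lemma size_mons i : size (mons i) = 'C(i + 2, 2).
Proof. by rewrite size_basis -bin_sub ?leq_addr // addKn. Qed.

Definition mon i (j : 'I_('C(i + 2, 2))) : 'X_{1..3} := nth 0%MM (mons i) j.

Lemma mdeg_mon i (j : 'I_('C(i + 2, 2))) : mdeg (mon j) = i.
Proof. by apply/eqP; rewrite -mem_mons mem_nth // size_mons. Qed.

Lemma mon_inj i : injective (@mon i).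
Proof.
move=> j l /eqP; rewrite nth_uniq ?uniq_mons ?size_mons // => /eqP.
exact: val_inj.
Qed.

Lemma monP i m : mdeg m = i -> exists j : 'I_('C(i + 2, 2)), m = mon j.
Proof.
move=> mi; have mm : m \in mons i by rewrite mem_mons mi.
have lt : (index m (mons i) < 'C(i + 2, 2))%N by rewrite -size_mons index_mem.
by exists (Ordinal lt); rewrite /mon nth_index.
Qed.

Section Coordinates.
Variables (k : fieldType) (i : nat).
Implicit Types (F : {mpoly k[3]}).

Definition coords F : 'rV[k]_('C(i + 2, 2)) := \row_j F@_(mon j).

Definition polyform (v : 'rV[k]_('C(i + 2, 2))) : {mpoly k[3]} :=
  \sum_j v 0 j *: 'X_[mon j].

Lemma coords_is_linear : linear coords.
Proof. by move=> c F G; apply/rowP => j; rewrite !mxE mcoeffD mcoeffZ. Qed.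

HB.instance Definition _ :=
  GRing.isLinear.Build k {mpoly k[3]} 'rV[k]_('C(i + 2, 2)) _ coords
    coords_is_linear.

Lemma polyform_is_linear : linear polyform.
Proof.
move=> c u v; rewrite /polyform scaler_sumr -big_split.
apply: eq_bigr => j _ /=.
by rewrite !mxE scalerDl scalerA.
Qed.

HB.instance Definition _ :=
  GRing.isLinear.Build k 'rV[k]_('C(i + 2, 2)) {mpoly k[3]} _ polyform
    polyform_is_linear.

Lemma coords_polyform : cancel polyform coords.
Proof.
move=> v; apply/rowP => j; rewrite mxE raddf_sum (bigD1 j) //=.
rewrite mcoeffZ mcoeffX eqxx mulr1 big1 ?addr0 // => l lj.
by rewrite mcoeffZ mcoeffX (inj_eq (@mon_inj i)) (negPf lj) mulr0.
Qed.

Lemma polyform_homog v : polyform v \is i.-homog.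
Proof.
by apply: rpred_sum => j _; apply: rpredZ; rewrite dhomogX /= mdeg_mon.
Qed.

Lemma coords_eq0 F : F \is i.-homog -> coords F = 0 -> F = 0.
Proof.
move=> /homog_mdegP Fh F0; apply/mpolyP => m; rewrite mcoeff0.
apply/eqP; apply: contraT => /[dup] /Fh /monP[j ->].
by move/rowP/(_ j): F0; rewrite !mxE => ->; rewrite eqxx.
Qed.

Lemma coordsK F : F \is i.-homog -> polyform (coords F) = F.
Proof.
move=> Fh; apply/eqP; rewrite -subr_eq0; apply/eqP; apply: coords_eq0.
  by rewrite rpredB ?polyform_homog.
by rewrite linearB /= coords_polyform subrr.
Qed.

Lemma dimle_homog : dimle (fun F : {mpoly k[3]} => F \is i.-homog) 'C(i + 2, 2).
Proof.
move=> r F HF lt; pose A := \matrix_(j < r) coords (F j).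
have : (0 < \rank (kermx A))%N.
  rewrite mxrank_ker subn_gt0; exact: leq_ltn_trans (rank_leq_col A) lt.
rewrite lt0n mxrank_eq0 => /rowV0Pn[c /sub_kermxP cA c0]; exists c => //.
apply: coords_eq0.
  by apply: rpred_sum => j _; apply: rpredZ; apply: HF.
rewrite linear_sum /=; transitivity (c *m A); last by [].
rewrite mulmx_sum_row; apply: eq_bigr => j _.
by rewrite linearZ rowK.
Qed.

End Coordinates.

Lemma bin2_mul2 n : ('C(n.+1, 2) * 2 = n.+1 * n)%N.
Proof. by elim: n => // n IH; rewrite binS bin1 mulnDl IH; lia. Qed.

Section Cubic.
Variable k : fieldType.
Hypothesis k0 : [pchar k] =i pred0.
Implicit Types (F G : {mpoly k[3]}).

Local Notation R := {mpoly k[3]}.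
Local Notation X0 := ('X_(ord0 : 'I_3) : R).
Local Notation X1 := ('X_(inord 1 : 'I_3) : R).
Local Notation X2 := ('X_(inord 2 : 'I_3) : R).
Local Notation Rc := ({mpoly k[3]} : comNzRingType).

Definition restr : R -> {poly k} := mmap (@polyC k) (pt 'X).

HB.instance Definition _ := GRing.RMorphism.on restr.

Lemma restrZ c F : restr (c *: F) = c *: restr F.
Proof. by rewrite /restr mmapZ mul_polyC. Qed.

Lemma restrX m : restr 'X_[m] = 'X^(m ord0 + 3 * m (inord 1)).
Proof.
rewrite /restr mmapX /mmap1 prod_ord3 /pt !vec3E expr1n mulr1.
by rewrite -exprM -exprD.
Qed.

Lemma restrE F : restr F =
  \sum_(m <- msupp F) F@_m *: 'X^(m ord0 + 3 * m (inord 1)).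
Proof.
rewrite {1}[F]mpolyE (rmorph_sum restr); apply: eq_bigr => m _.
by rewrite [LHS]restrZ restrX.
Qed.

(** A monomial with exponents a, b, c restricts to degree a + 3 b = 3 i - (2 a + 3 c), and 2 a + 3 c
    is never 1: this gap is the trace of the cusp. *)
Lemma coef_restr F i e : F \is i.-homog -> (3 * i < e \/ e.+1 = 3 * i)%N ->
  (restr F)`_e = 0.
Proof.
move=> /homog_mdegP Fh ei; rewrite restrE coef_sum big1_seq // => m /= mF.
rewrite coefZ coefXn; case: eqP => [E|_]; last by rewrite mulr0.
have := Fh m; rewrite mdeg_ord3 -mcoeff_msupp mF => /(_ isT).
lia.
Qed.

Definition cusp : R := X1 * X2 ^+ 2 - X0 ^+ 3.

Lemma restr_cusp_homog F i : F \is i.-homog ->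
  mmap (@mpolyC 3 k) (vec3 (X0 * X2 ^+ 2) (X0 ^+ 3) (X2 ^+ 3)) F =
  \sum_(e < (3 * i).+1) (restr F)`_e *: (X0 ^+ e * X2 ^+ (3 * i - e)).
Proof.
move=> /homog_mdegP Fh; rewrite restrE.
under [RHS]eq_bigr do rewrite coef_sum scaler_suml.
rewrite [RHS]exchange_big /=; apply: eq_big_seq => m mF.
have := Fh m; rewrite mdeg_ord3 -mcoeff_msupp mF => /(_ isT) mi.
have lt : (m ord0 + 3 * m (inord 1) < (3 * i).+1)%N by lia.
rewrite (bigD1 (Ordinal lt)) //= coefZ coefXn eqxx mulr1.
rewrite big1 ?addr0 => [|e ne]; last first.
  rewrite coefZ coefXn; case: eqP => [E|_]; last by rewrite mulr0 scale0r.
  by case/eqP: ne; apply: val_inj.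
rewrite /mmap1 prod_ord3 !vec3E mul_mpolyC; congr (_ *: _).
rewrite exprMn -!exprM -mulrA mulrACA -!exprD; congr (_ * _ ^+ _).
lia.
Qed.

Lemma size_restr F i : F \is i.-homog -> (size (restr F) <= (3 * i).+1)%N.
Proof.
move=> Fh; apply/leq_sizeP => e ie; apply: (coef_restr Fh); left.
exact: ie.
Qed.

Lemma homog_cusp : cusp \is 3.-homog.
Proof.
apply: rpredB; last exact: (dhomogMn 3 (homog_U _ _)).
exact: (dhomogM (homog_U _ _) (dhomogMn 2 (homog_U _ _))).
Qed.

(* The branch of the cuspidal cubic at a smooth point is not singular:
   the linear term in s of cusp(pt t + s X) is nonzero. *)
Lemma expand_cusp (t : k) : exists2 V : {poly R}, ~ divides 'X V &
  expand (pt t) cusp = 'X * V.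
Proof.
have [E0 E1 E2] := expand_pt t.
pose T : {poly R} := t%:MP%:P; pose x := X0%:P; pose y := X1%:P.
pose z := X2%:P.
pose l : R := X1 + (t ^+ 3 *+ 2) *: X2 - (t ^+ 2 *+ 3) *: X0.
pose W := y * z *+ 2 + T ^+ 3 * z ^+ 2 - T * x ^+ 2 *+ 3
  + 'X * (y * z ^+ 2 - x ^+ 3).
exists ('X * W + l%:P).
  move/dividesXD/(congr1 (mcoeff U_(inord 1))).
  rewrite mcoeffB mcoeffD !mcoeffZ.
  rewrite !mcoeffX mcoeff0 eqxx !eq_mnm1.
  rewrite -!(inj_eq val_inj) /= !inordK //= !mulr0 subr0 addr0 => /eqP.
  by rewrite oner_eq0.
have El : l%:P = y + T ^+ 3 *+ 2 * z - T ^+ 2 *+ 3 * x.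
  rewrite /l -!mul_mpolyC !polyCB !polyCD !polyCM -/x -/y -/z.
  by rewrite !mpolyCMn !polyCMn !rmorphXn.
rewrite El {El}.
have -> : expand (pt t) cusp =
    ('X * y + T ^+ 3) * ('X * z + 1) ^+ 2 - ('X * x + T) ^+ 3.
  have := rmorphB (expand (pt t)) (X1 * X2 ^+ 2) (X0 ^+ 3).
  move=> ->; congr (_ - _).
    have := rmorphM (expand (pt t)) X1 (X2 ^+ 2) => ->.
    congr (_ * _); first exact: E1.
    have := rmorphXn (expand (pt t)) 2 X2 => ->; congr (_ ^+ _); exact: E2.
  have := rmorphXn (expand (pt t)) 3 X0 => ->; congr (_ ^+ _); exact: E0.
by rewrite /W; clearbody x y z T; clear; move: ('X) => s; ring.
Qed.

(** Modulo [cusp], X2^(2 i) F = F(X0 X2^2, X1 X2^2, X2^3) becomes F(X0 X2^2, X0^3, X2^3), the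
    homogenized restriction, which is zero. The power of X2 cancels because X2 is prime and does not
    divide [cusp]. *)
Lemma restr_eq0 F i : F \is i.-homog -> restr F = 0 -> divides cusp F.
Proof.
move=> Fh F0.
pose q := vec3 (X0 * X2 ^+ 2) (X1 * X2 ^+ 2) (X2 ^+ 3).
have Fq : mmap (@mpolyC 3 k) q F = (X2 ^+ 2) ^+ i * F.
  rewrite (@mmap_eq _ _ _ _ (@mpolyC 3 k) _ (fun j => X2 ^+ 2 * 'X_j)) //.
    rewrite (mmap_scale (@mpolyC 3 k) _ _ Fh); congr (_ * _).
    exact: mmap_id.
  by apply: ord3_ind; rewrite /q vec3E ?[_ * X2 ^+ 2]mulrC // -exprSr.
have dq : divides cusp (mmap (@mpolyC 3 k) q F).
  pose q' := vec3 (X0 * X2 ^+ 2) (X0 ^+ 3) (X2 ^+ 3).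
  have q'0 : mmap (@mpolyC 3 k) q' F = 0.
    rewrite (restr_cusp_homog Fh) big1 // => e _.
    by rewrite F0 coef0 scale0r.
  rewrite -[mmap _ _ _]subr0 -[X in _ - X]q'0; apply: mmap_congr.
  apply: ord3_ind; rewrite /q /q' !vec3E.
  - by exists 0; rewrite subrr mulr0.
  - by exists 1; rewrite mulr1.
  - by exists 0; rewrite subrr mulr0.
pose f := [the {rmorphism R -> R} of mmap (@mpolyC 3 k) (vec3 X0 X1 0)].
have fX j : f 'X_j = vec3 X0 X1 0 j by rewrite /= mmapX mmap1U.
have f0 := fX ord0; have f1 := fX (inord 1); have f2 := fX (inord 2).
rewrite !vec3E in f0 f1 f2.
have [||H Hp] := @prime_retract _ X2 f.
- exact: f2.
- move=> G; rewrite -{1}[G]mmap_id; apply: mmap_congr.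
  apply: ord3_ind; rewrite vec3E; first by exists 0; rewrite subrr mulr0.
    by exists 0; rewrite subrr mulr0.
  by exists 1; rewrite mulr1 subr0.
have nd : ~ divides X2 cusp.
  move/H; rewrite /cusp rmorphB rmorphM !rmorphXn f0 f1 f2 expr0n mulr0 sub0r.
  move=> /eqP; rewrite oppr_eq0 expf_eq0 /= => /eqP /(congr1 (mcoeff U_(ord0))).
  by rewrite mcoeffX mcoeff0 eqxx => /eqP; rewrite oner_eq0.
have [G EG] := dq; rewrite Fq -exprM in EG.
have : divides (X2 ^+ (2 * i)) (cusp * G) by exists F; rewrite EG.
move=> /(prime_expl Hp nd)[G' EG']; exists G'.
apply: (@mulfI _ (X2 ^+ (2 * i))).
  rewrite expf_neq0 //; apply/eqP => /(congr1 (mcoeff U_(inord 2))).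
  by rewrite mcoeffX mcoeff0 eqxx => /eqP; rewrite oner_eq0.
by rewrite EG EG' mulrCA.
Qed.

Definition usys (ts : seq k) i m F :=
  F \is i.-homog /\ forall t, t \in ts -> mult (pt t) i m F.

Lemma restr_usys ts i m F t : usys ts i m F -> t \in ts ->
  ('X - t%:P) ^+ m %| restr F.
Proof.
case=> Fh Fm tts.
(* [w] is the difference of the points with parameters ['X] and t, divided by ['X - t%:P]. *)
pose w : 'I_3 -> {poly k} := vec3 1 ('X ^+ 2 + 'X * t%:P + t%:P ^+ 2) 0.
have := mult_divides k0 (@polyC k) w 1 ('X - t%:P) Fh (Fm t tts).
rewrite (@mmap_eq _ _ _ _ (@polyC k) _ (pt 'X)) //; last first.
  apply: ord3_ind; rewrite /w /pt !vec3E; first by ring.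
    by rewrite rmorphXn /=; ring.
  by rewrite mulr0 add0r mulr1.
by case=> q E; rewrite /restr E dvdp_mulr.
Qed.

Lemma dvdp_prod_exp (ts : seq k) m (p : {poly k}) : uniq ts ->
  (forall t, t \in ts -> ('X - t%:P) ^+ m %| p) ->
  (\prod_(t <- ts) ('X - t%:P)) ^+ m %| p.
Proof.
elim: ts => [|t ts IH] /=; first by rewrite big_nil expr1n dvd1p.
move=> /andP[tts uts] H; rewrite big_cons exprMn Gauss_dvdp.
  rewrite H ?mem_head //=; apply: IH => // s sts; apply: H.
  by rewrite in_cons sts orbT.
apply/coprimep_expl/coprimep_expr; rewrite coprimep_sym coprimep_XsubC.
rewrite root_prod_XsubC; exact: tts.
Qed.

Section Fiber.
Variables (ts : seq k) (i m : nat).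
Hypotheses (uts : uniq ts) (im : (size ts * m < 3 * i)%N).

Let s := (3 * i - size ts * m)%N.
Let P : {poly k} := (\prod_(t <- ts) ('X - t%:P)) ^+ m.

Let Pmonic : P \is monic.
Proof. by apply: monic_exp; apply: monic_prod_XsubC. Qed.

Let sizeP : size P = (size ts * m).+1.
Proof.
have := size_exp (\prod_(t <- ts) ('X - t%:P)) m.
rewrite size_prod_XsubC /= -/P => <-; rewrite prednK // size_poly_gt0.
exact: monic_neq0.
Qed.

(* Forms of degree i restrict to polynomials in t of degree at most 3i with no
   term of degree 3i - 1, so after division by P the coefficients of degree
   0, ..., s - 2 and s determine the restriction. *)
Let phi F : 'rV[k]_s :=
  \row_(l < s) (restr F %/ P)`_(if l == s.-1 :> nat then s else l).

Let phiD F G : phi (F + G) = phi F + phi G.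
Proof.
apply/rowP => l; rewrite !mxE -coefD; congr (_`_ _).
by rewrite (rmorphD restr) divpD.
Qed.

Let phiZ c F : phi (c *: F) = c *: phi F.
Proof. by apply/rowP => l; rewrite !mxE -coefZ restrZ divpZl. Qed.

Let phi0 : phi 0 = 0.
Proof. by rewrite -[0 in LHS](scale0r 0) phiZ scale0r. Qed.

Let phi_eq0 F : usys ts i m F -> phi F = 0 -> restr F = 0.
Proof.
move=> LF pF; have [Fh Fm] := LF.
have PF : P %| restr F by apply: dvdp_prod_exp => // t; apply: restr_usys LF.
have := divpK PF; set q := restr F %/ P in pF * => Eq.
have s0 : (0 < s)%N by rewrite subn_gt0.
have q0 l : (l < s.-1)%N || (l == s) -> q`_l = 0.
  case/orP=> [ls|/eqP ->].
    have lts : (l < s)%N by lia.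
    by move/rowP/(_ (Ordinal lts)): pF; rewrite !mxE /= ltn_eqF.
  have lts : (s.-1 < s)%N by lia.
  by move/rowP/(_ (Ordinal lts)): pF; rewrite !mxE /= eqxx.
have sq : (size q <= s.+1)%N.
  have := size_restr Fh; rewrite -Eq; have [->|nq] := eqVneq q 0.
    by rewrite size_poly0.
  rewrite size_Mmonic // sizeP /s addnS /= => le.
  by rewrite -(leq_add2r (size ts * m)) addSn subnK // ltnW.
have Eq2 : q = q`_(s.-1) *: 'X^(s.-1).
  apply/polyP => l; rewrite coefZ coefXn; case: eqP => [->|/eqP ls].
    by rewrite mulr1.
  rewrite mulr0; have [lt|] := ltnP l s.+1.
    by apply: q0; lia.
  by move=> sl; apply: nth_default; apply: leq_trans sl.
(* Only the coefficient of degree s - 1 of q is left. As P is monic, it is the coefficient of degree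
   3 i - 1 of the restriction, hence zero. *)
have E : (restr F)`_(3 * i).-1 = 0 by apply: (coef_restr Fh); right; lia.
move: E Eq2; move: (q`_(s.-1)) => a E Eq2.
suff a0 : a = 0 by rewrite -Eq Eq2 a0 scale0r mul0r.
move: E; rewrite -Eq Eq2 -scalerAl coefZ coefXnM.
have -> : ((3 * i).-1 < s.-1)%N = false by rewrite /s; lia.
have -> : ((3 * i).-1 - s.-1 = (size P).-1)%N by rewrite sizeP /s; lia.
by rewrite -/(lead_coef P) (monicP Pmonic) mulr1.
Qed.

(** A form in the kernel of [phi] is [cusp] times a form of degree i - 3. The cubic is smooth at the
    points, so the cofactor loses only one order of multiplicity. *)
Lemma dimle_fiber_cubic N :
  dimle (usys ts (i - 3) (m - 1)) N -> dimle (usys ts i m) (N + s).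
Proof.
apply: (dimle_fiber (phi := phi) (g := cusp)) => [r F c LF|F LF pF].
  split.
    split=> [|t tts].
      by apply: rpred_sum => j _; apply: rpredZ; case: (LF j).
    by rewrite /mult iter_dirder_sum big1 // => j _; rewrite (LF j).2 ?scaler0.
  rewrite (big_morph phi phiD phi0); apply: eq_bigr => j _; exact: phiZ.
have [Fh Fm] := LF; have [G EG] := restr_eq0 Fh (phi_eq0 LF pF).
have [F0|F0] := eqVneq F 0.
  exists 0; first by rewrite F0 mulr0.
  by split=> [|t _]; [apply: rpred0 | apply: mult_zero].
have G0 : G != 0 by apply: contraNneq F0 => G0; rewrite EG G0 mulr0.
have c0 : cusp != 0 by apply: contraNneq F0 => c0; rewrite EG c0 mul0r.
have [i3 Gh] : (3 <= i)%N /\ G \is (i - 3).-homog.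
  by apply: (homog_factor c0 homog_cusp G0); rewrite -EG.
exists G => //; split=> // t tts; apply/(multP k0) => //.
have /(multP k0) := Fm t tts => /(_ Fh) [y]; rewrite EG.
have [V XV EV] := expand_cusp t.
have := rmorphM (expand (pt t)) cusp G => -> /=; rewrite EV.
case: (m) => [|e] E; first by exists (expand (pt t) G); rewrite mul1r.
rewrite subSS subn0; apply: (prime_expl (@primeX _) XV).
exists y; apply: (mulfI (negbT (polyX_eq0 _))).
by rewrite mulrA E exprS mulrA.
Qed.

End Fiber.

(** Passing from (i; m) to (i - 3; m - 1) lowers the expected dimension by exactly 3 i - 8 m,
    preserves 3 m <= i, and stops at m = 0 with all forms of the remaining degree. *)
Lemma dimle_usys ts i m : uniq ts -> size ts = 8 -> (3 * m <= i)%N ->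
  dimle (usys ts i m) ('C(i + 2, 2) - 8 * 'C(m + 1, 2)).
Proof.
move=> uts s8; elim: m i => [|m IH] i im.
  rewrite (_ : 'C(0 + 1, 2) = 0)%N // muln0 subn0.
  by apply: dimle_sub (@dimle_homog k i) => F [].
have lt : (size ts * m.+1 < 3 * i)%N by rewrite s8; lia.
have := dimle_fiber_cubic uts lt (N := 'C(i - 3 + 2, 2) - 8 * 'C(m + 1, 2)).
rewrite subSS subn0 s8 => /(_ (IH _ _)).
case: i im {lt} => [|[|[|i]]]; try lia; rewrite !subSS subn0 => im H.
rewrite (_ : _ - _ = 'C(i + 2, 2) - 8 * 'C(m + 1, 2) + (3 * i.+3 - 8 * m.+1))%N.
  by apply: H; lia.
have := bin2_mul2 (i + 1); have := bin2_mul2 m.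
rewrite !(addn1, addn2, addn3, addSn) !binS !bin1 !bin0.
by nia.
Qed.

End Cubic.

(* The Euler characteristic is invariant under the Bertini involution. *)
Lemma bertini_euler i m : (48 * m <= 17 * i)%N -> (17 * m <= 6 * i)%N ->
  ('C(i + 2, 2) + 8 * 'C((6 * i - 17 * m) + 1, 2) =
   'C(17 * i - 48 * m + 2, 2) + 8 * 'C(m + 1, 2))%N.
Proof.
move=> im le; have := bin2_mul2 (i + 1); have := bin2_mul2 m.
have := bin2_mul2 (17 * i - 48 * m + 1); have := bin2_mul2 (6 * i - 17 * m).
rewrite !(addn1, addn2).
set A := 'C(_, _); set B := 'C(_, _); set C := 'C(_, _); set D := 'C(_, _).
move=> HA HB HC HD; suff : ((D + 8 * A) * 2 = (B + 8 * C) * 2)%N by lia.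
have [x Ex] : exists x, (x + 17 * m = 6 * i)%N.
  by exists (6 * i - 17 * m)%N; lia.
have [y Ey] : exists y, (y + 48 * m = 17 * i)%N.
  by exists (17 * i - 48 * m)%N; lia.
rewrite -Ex -Ey !addnK in HA HB; nia.
Qed.

(** * Upper bound for the chosen points *)

Section UpperBound.
Variable k : fieldType.
Hypothesis k0 : [pchar k] =i pred0.
Implicit Types (F G : {mpoly k[3]}).

Definition cfg e : seq k := [seq z%:~R | z <- config e].

Lemma isys_usys t i m F : isys t (nseq (size t) m) i F <->
  usys [seq z%:~R | z <- t] i m F.
Proof.
split=> -[Fh Fm]; (split; first exact: Fh); last first.
  by move=> j jt; rewrite nth_nseq jt; apply: Fm; apply/map_f/mem_nth.
move=> _ /mapP[z zt ->].
have jt : (index z t < size t)%N by rewrite index_mem.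
by have := Fm _ jt; rewrite nth_index // nth_nseq jt.
Qed.

Lemma cfg_uniq e : uniq (config e) -> uniq (cfg e).
Proof. by rewrite map_inj_uniq //; apply: intf_inj. Qed.

(* [bertini_eq0] needs 45 m <= 16 i. Passing to a power of F and rounding the
   multiplicity down to the least value with 17 i < 48 m achieves this. *)
Lemma usys_cfg_eq0 i m F : (0 < i)%N -> (17 * i < 48 * m)%N ->
  usys (cfg 0) i m F -> F = 0.
Proof.
(* Here M = 255 i + 1, so 45 M <= 16 I reads 45 <= 45 i, and M <= 720 m follows from 17 i < 48 m. *)
move=> i0 im [Fh Fm]; pose I := (i * 720)%N; pose M := ((17 * I) %/ 48).+1.
have /eqP : F ^+ 720 = 0.
  apply: (bertini_eq0 k0 (i := I) (m := M)); [rewrite /M /I; lia.. |].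
  apply/isys_usys; split=> [|t tc]; first exact: dhomogMn.
  apply: (mult_le (m := m * 720)); first by rewrite /M /I; lia.
  exact: (multX k0 720 Fh (Fm t tc)).
by rewrite expf_eq0 => /eqP.
Qed.

(** The involution changes the sign of i - 3 m, so the restriction argument applies either to the
    class or to its image; both have the same expected dimension. *)
Lemma dimle_usys_cfg i m : (48 * m <= 17 * i)%N ->
  dimle (usys (cfg 0) i m)
    ('C(17 * i - 48 * m + 2, 2) - 8 * 'C((6 * i - 17 * m) + 1, 2)).
Proof.
move=> im; have [mi|mi] := leqP (3 * m) i.
  have ucfg : uniq (cfg 0) by apply: cfg_uniq.
  have := dimle_usys k0 ucfg erefl mi.
  suff -> : ('C(i + 2, 2) - 8 * 'C(m + 1, 2) =
    'C(17 * i - 48 * m + 2, 2) - 8 * 'C((6 * i - 17 * m) + 1, 2))%N by [].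
  have := @bertini_euler i m im; lia.
apply: (dimle_sub (L' := @isys k (config 0) (nseq 8 m) i)).
  by move=> F /isys_usys.
apply: dimle_bertini => //; first by lia.
apply: (dimle_sub (L' := usys (cfg 8) (17 * i - 48 * m) (6 * i - 17 * m))).
  by move=> F /isys_usys.
by apply: (@dimle_usys k k0 (cfg 8)); [exact: cfg_uniq | | lia].
Qed.

End UpperBound.

(** * Apolarity *)

Section Apolarity.
Variable k : fieldType.
Hypothesis k0 : [pchar k] =i pred0.
Implicit Types (F G h : {mpoly k[3]}) (P : 'I_3 -> k).

Definition mfact (m : 'X_{1..3}) : nat := (\prod_j (m j)`!)%N.

Lemma mfact_gt0 m : (0 < mfact m)%N.
Proof. by apply: prodn_gt0 => j; apply: fact_gt0. Qed.

Lemma mfactD m j : mfact (m + U_(j)) = ((m j).+1 * mfact m)%N.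
Proof.
rewrite /mfact (bigD1 j) //= [in RHS](bigD1 j) //= mnmDE mnm1E eqxx addn1.
rewrite factS -mulnA; congr (_ * (_ * _))%N; apply: eq_bigr => l lj.
by rewrite mnmDE mnm1E eq_sym (negPf lj) addn0.
Qed.

(** The pairing of forms of degree i in which h acts on F as a differential operator; the factorials
    make multiplication by a variable adjoint to differentiation. *)
Definition apolar i F h : k :=
  \sum_(j < 'C(i + 2, 2)) (mfact (mon j))%:R * F@_(mon j) * h@_(mon j).

Lemma apolarX i F m : mdeg m = i -> apolar i F 'X_[m] = (mfact m)%:R * F@_m.
Proof.
move=> /monP[j ->]; rewrite /apolar (bigD1 j) //= mcoeffX eqxx mulr1.
rewrite big1 ?addr0 // => l lj.
by rewrite mcoeffX (inj_eq (@mon_inj i)) eq_sym (negPf lj) mulr0.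
Qed.

Lemma apolar_sumr i F (I : finType) (c : I -> k) (H : I -> {mpoly k[3]}) :
  apolar i F (\sum_l c l *: H l) = \sum_l c l * apolar i F (H l).
Proof.
rewrite /apolar; under [RHS]eq_bigr do rewrite mulr_sumr.
rewrite [RHS]exchange_big; apply: eq_bigr => j _ /=.
rewrite raddf_sum mulr_sumr; apply: eq_bigr => l _ /=.
by rewrite mcoeffZ mulrCA.
Qed.

Lemma apolar_suml i h (I : finType) (c : I -> k) (H : I -> {mpoly k[3]}) :
  apolar i (\sum_l c l *: H l) h = \sum_l c l * apolar i (H l) h.
Proof.
rewrite /apolar; under [RHS]eq_bigr do rewrite mulr_sumr.
rewrite [RHS]exchange_big; apply: eq_bigr => j _ /=.
rewrite raddf_sum mulr_sumr mulr_suml; apply: eq_bigr => l _ /=.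
by rewrite mcoeffZ; ring.
Qed.

Lemma homog_sumX i h : h \is i.-homog ->
  h = \sum_(l < 'C(i + 2, 2)) h@_(mon l) *: 'X_[mon l].
Proof.
move=> hh; rewrite -[LHS](coordsK hh) /polyform.
by apply: eq_bigr => l _; rewrite mxE.
Qed.

Lemma apolar_mulX i F h j : h \is i.-homog ->
  apolar i.+1 F ('X_j * h) = apolar i F^`M(j) h.
Proof.
move=> /homog_sumX ->; rewrite mulr_sumr.
under eq_bigr do rewrite -scalerAr.
rewrite !apolar_sumr; apply: eq_bigr => l _; congr (_ * _).
rewrite -mpolyXD addmC !apolarX ?mdeg_mon //; last first.
  by rewrite mdegD mdeg1 mdeg_mon addn1.
by rewrite mcoeff_deriv mfactD natrM -mulrA mulr_natl mulrnAr.
Qed.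

Definition lform P : {mpoly k[3]} := \sum_j P j *: 'X_j.

Lemma homog_lform P : lform P \is 1.-homog.
Proof.
by apply: rpred_sum => j _; apply: rpredZ; apply: homog_U.
Qed.

Lemma homog_lformX P e h i : h \is i.-homog ->
  lform P ^+ e * h \is (e + i).-homog.
Proof.
move=> hh; have := dhomogM (dhomogMn e (homog_lform P)) hh.
by rewrite mul1n.
Qed.

Lemma apolar_lform P i F h e : h \is i.-homog ->
  apolar (e + i) F (lform P ^+ e * h) = apolar i (iter e (dirder P) F) h.
Proof.
move=> hh; elim: e F => [|e IH] F; first by rewrite expr0 mul1r.
rewrite iterSr -IH exprS -mulrA addSn /lform mulr_suml.
under eq_bigr do rewrite -scalerAl.
rewrite apolar_sumr apolar_suml; apply: eq_bigr => j _; congr (_ * _).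
by apply: apolar_mulX; apply: homog_lformX.
Qed.

Lemma apolar_nondeg i F : F \is i.-homog ->
  (forall j, apolar i F 'X_[@mon i j] = 0) -> F = 0.
Proof.
move=> Fh F0; apply: (coords_eq0 Fh); apply/rowP => j; rewrite !mxE.
have /eqP := F0 j; rewrite apolarX ?mdeg_mon // mulf_eq0 natf0 //.
by rewrite eqn0Ngt mfact_gt0 => /eqP.
Qed.

Section GeneratorMatrix.
Variables (q : nat) (a : 'M[k]_(q, 3)) (e : 'I_q -> nat) (i : nat).

Local Notation N := 'C(i + 2, 2).

Definition gen_index := {j : 'I_q & 'I_('C(i - e j + 2, 2))}.

Definition generator (r : gen_index) : {mpoly k[3]} :=
  lform (a (tag r)) ^+ e (tag r) * 'X_[mon (tagged r)].

(** The row space is the degree i part of the ideal generated by the powers. If e j > i, the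
    truncated i - e j leaves one generator, of degree e j, whose row of degree i coordinates is
    zero. *)
Definition powmx : 'M[k]_(#|{: gen_index}|, N) :=
  \matrix_r coords i (generator (enum_val r)).

(* The forms of degree i with multiplicity i + 1 - e j at the j-th row of a. *)
Definition fat F := F \is i.-homog /\
  forall j, iter (e j) (dirder (a j)) F = 0.

Definition wform (v : 'rV[k]_N) : {mpoly k[3]} :=
  polyform (\row_j (v 0 j / (mfact (mon j))%:R)).

Definition wcoords F : 'rV[k]_N := \row_j ((mfact (mon j))%:R * F@_(mon j)).

Lemma mfactf_neq0 m : (mfact m)%:R != 0 :> k.
Proof. by rewrite natf0 // -lt0n mfact_gt0. Qed.

Lemma wformK : cancel wform wcoords.
Proof.
move=> v; apply/rowP => j; rewrite mxE /wform.
have := coords_polyform (\row_j (v 0 j / (mfact (mon j))%:R)) => /rowP/(_ j).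
by rewrite !mxE => ->; rewrite mulrCA divff ?mfactf_neq0 // mulr1.
Qed.

Lemma coords_wcoords F h : coords i h *m (wcoords F)^T = (apolar i F h)%:M.
Proof.
apply/rowP => c; rewrite ord1 !mxE eqxx mulr1n; apply: eq_bigr => j _.
by rewrite !mxE mulrC.
Qed.

Lemma homog_generator r : generator r \is (e (tag r) + (i - e (tag r))).-homog.
Proof. by apply: homog_lformX; rewrite dhomogX /= mdeg_mon. Qed.

(** Apolarity: F is orthogonal to all multiples of the power of a linear form exactly when the
    corresponding iterated derivative of F is orthogonal to all monomials of its degree, hence
    zero. *)
Lemma powmx_fat F : F \is i.-homog ->
  powmx *m (wcoords F)^T = 0 <-> fat F.
Proof.
move=> Fh.
have E (r : gen_index) : (e (tag r) <= i)%N -> apolar i F (generator r) =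
    apolar (i - e (tag r)) (iter (e (tag r)) (dirder (a (tag r))) F)
      'X_[mon (tagged r)].
  move=> le; have := @apolar_lform (a (tag r)) (i - e (tag r)) F
    'X_[mon (tagged r)] (e (tag r)).
  by rewrite subnKC //; apply; rewrite dhomogX /= mdeg_mon.
split=> [F0|[_ F0]].
  split=> // j; have [ej|ej] := leqP (e j) i; last first.
    exact: (iter_dirder_eq0 _ Fh).
  apply: (apolar_nondeg (iter_dirder_homog _ _ Fh)) => l.
  pose r : gen_index := Tagged (fun j => 'I_('C(i - e j + 2, 2))) l.
  have := congr1 (row (enum_rank r)) F0; rewrite row_mul rowK enum_rankK row0.
  by rewrite coords_wcoords E //= => /rowP/(_ 0); rewrite !mxE.
apply/row_matrixP => r; rewrite row_mul rowK row0 coords_wcoords.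
set g := enum_val r; suff -> : apolar i F (generator g) = 0 by rewrite raddf0.
have [ej|ej] := leqP (e (tag g)) i.
  rewrite E // F0 /apolar big1 // => j _.
  by rewrite mcoeff0 mulr0 mul0r.
rewrite /apolar big1 // => j _; have /homog_mdegP gh := homog_generator g.
have [->|] := eqVneq (generator g)@_(mon j) 0; first by rewrite mulr0.
move=> /gh; rewrite mdeg_mon => Ei; exfalso; move: ej; rewrite ltnNge.
by rewrite [leqRHS]Ei leq_addr.
Qed.

Lemma fat_sum r (F : 'I_r -> {mpoly k[3]}) (c : 'I_r -> k) :
  (forall l, fat (F l)) -> fat (\sum_l c l *: F l).
Proof.
move=> HF; split=> [|j].
  by apply: rpred_sum => l _; apply: rpredZ; case: (HF l).
by rewrite iter_dirder_sum big1 // => l _; have [_ ->] := HF l; rewrite scaler0.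
Qed.

Lemma exists_fat_family : exists F : 'I_(N - \rank powmx) -> {mpoly k[3]},
  (forall l, fat (F l)) /\
  forall c : 'rV[k]_(N - \rank powmx), \sum_l c 0 l *: F l = 0 -> c = 0.
Proof.
pose B := row_base (kermx powmx^T).
have rk : \rank (kermx powmx^T) = (N - \rank powmx)%N.
  by rewrite mxrank_ker mxrank_tr.
rewrite -rk; exists (fun l => wform (row l B)); split=> [l|c].
  have wh : wform (row l B) \is i.-homog by apply: polyform_homog.
  apply/(powmx_fat wh); rewrite wformK; apply: trmx_inj.
  rewrite trmx_mul trmxK trmx0; apply/sub_kermxP.
  by rewrite (submx_trans (row_sub _ _)) // eq_row_base.
have -> : \sum_l c 0 l *: wform (row l B) = wform (c *m B).
  rewrite mulmx_sum_row /wform /polyform; under eq_bigr do rewrite scaler_sumr.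
  rewrite exchange_big; apply: eq_bigr => j _ /=.
  rewrite !mxE summxE mulr_suml scaler_suml; apply: eq_bigr => l _.
  by rewrite scalerA !mxE mulrA.
move=> w0; have : c *m B = 0.
  rewrite -[LHS]wformK w0; apply/rowP => j.
  by rewrite !mxE mcoeff0 mulr0.
by move=> cB; apply: (row_free_inj (row_base_free _)); rewrite cB mul0mx.
Qed.

Lemma rank_powmx_lower M : dimle fat M -> (N <= \rank powmx + M)%N.
Proof.
move=> HM; have [F [LF free]] := exists_fat_family.
rewrite leqNgt; apply/negP => lt; have [|c c0 cF] := HM _ F LF; first by lia.
by case/eqP: c0; apply: free.
Qed.

Lemma rank_powmx_upper r (F : 'I_r -> {mpoly k[3]}) :
  (forall l, fat (F l)) ->
  (forall c : 'rV[k]_r, \sum_l c 0 l *: F l = 0 -> c = 0) ->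
  (\rank powmx + r <= N)%N.
Proof.
move=> LF free; pose V := \matrix_l wcoords (F l).
have Fh l : F l \is i.-homog by case: (LF l).
have VA : powmx *m V^T = 0.
  apply: trmx_inj; rewrite trmx_mul trmxK trmx0; apply/row_matrixP => l.
  rewrite row_mul rowK row0; apply: trmx_inj; rewrite trmx_mul trmxK trmx0.
  exact/powmx_fat.
have Vfree : row_free V.
  rewrite -kermx_eq0; apply/eqP/row_matrixP => l; rewrite row0; apply: free.
  have : row l (kermx V) *m V = 0 by rewrite -row_mul mulmx_ker row0.
  move: (row l _) => c; rewrite mulmx_sum_row => cV; apply: coords_eq0.
    by apply: (fat_sum _ LF).1.
  apply/rowP => j; move/rowP/(_ j): cV; rewrite !mxE summxE raddf_sum /=.
  under eq_bigr do rewrite rowK !mxE mulrCA.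
  rewrite -mulr_sumr => /eqP; rewrite mulf_eq0 (negPf (mfactf_neq0 _)) /=.
  move=> /eqP E; etransitivity; last exact: E.
  by apply: eq_bigr => x _; rewrite mcoeffZ.
have := mulmx0_rank_max VA; rewrite mxrank_tr.
by move: Vfree; rewrite /row_free => /eqP ->.
Qed.

Lemma rank_powmx_le : (\rank powmx <= \sum_j 'C(i - e j + 2, 2))%N.
Proof.
apply: leq_trans (rank_leq_row _) _.
rewrite card_tagged sumnE big_map big_enum /=.
by apply: leq_sum => j _; rewrite card_ord.
Qed.

End GeneratorMatrix.
End Apolarity.

(** * Semicontinuity *)

Section Regular.
Variables (k : fieldType) (r n : nat).
Implicit Types (g : 'M[k]_(r, n) -> k) (a : 'M[k]_(r, n)).

(** Polynomial functions of the entries, in the encoding of [zariski_open]. *)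
Definition regular g :=
  exists f : {mpoly k[r * n]}, forall a, g a = f.@[fun s => mxvec a ord0 s].

Lemma regular_const c : regular (fun=> c).
Proof. by exists c%:MP => a; rewrite mevalC. Qed.

Lemma regular_entry i j : regular (fun a => a i j).
Proof. by exists 'X_(mxvec_index i j) => a; rewrite mevalXU mxvecE. Qed.

Lemma regularM g h : regular g -> regular h -> regular (fun a => g a * h a).
Proof. by move=> [f Ef] [e Ee]; exists (f * e) => a; rewrite mevalM Ef Ee. Qed.

Lemma regular_sum (I : Type) (s : seq I) (P : pred I)
    (g : I -> 'M[k]_(r, n) -> k) :
  (forall i, regular (g i)) -> regular (fun a => \sum_(i <- s | P i) g i a).
Proof.
move=> Hg; elim: s => [|i s [f IH]].
  by exists 0 => a; rewrite big_nil meval0.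
have [e Ee] := Hg i; case Pi: (P i).
  by exists (e + f) => a; rewrite big_cons Pi mevalD IH Ee.
by exists f => a; rewrite big_cons Pi.
Qed.

Lemma regular_prod (I : Type) (s : seq I) (P : pred I)
    (g : I -> 'M[k]_(r, n) -> k) :
  (forall i, regular (g i)) -> regular (fun a => \prod_(i <- s | P i) g i a).
Proof.
move=> Hg; elim: s => [|i s [f IH]].
  by exists 1 => a; rewrite big_nil meval1.
have [e Ee] := Hg i; case Pi: (P i).
  by exists (e * f) => a; rewrite big_cons Pi mevalM IH Ee.
by exists f => a; rewrite big_cons Pi.
Qed.

Lemma regular_det q (A : 'M[k]_(r, n) -> 'M[k]_q) :
  (forall i j, regular (fun a => A a i j)) -> regular (fun a => \det (A a)).
Proof.
move=> HA; apply: regular_sum => s.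
by apply: regularM; [apply: regular_const | apply: regular_prod].
Qed.

Lemma regular_mulmx p q t (A : 'M[k]_(r, n) -> 'M[k]_(p, q))
    (B : 'M[k]_(r, n) -> 'M[k]_(q, t)) :
  (forall i j, regular (fun a => A a i j)) ->
  (forall i j, regular (fun a => B a i j)) ->
  forall i j, regular (fun a => (A a *m B a) i j).
Proof.
move=> HA HB i j.
have [f Ef] : regular (fun a => \sum_l A a i l * B a l j).
  by apply: regular_sum => l; apply: regularM.
by exists f => a; rewrite mxE Ef.
Qed.

(* If L (A a0) M = 1, where 1 has the size of the rank of A a0, then the rank
   of A a is at least that of A a0 wherever det (L (A a) M) is nonzero. *)
Lemma rank_lower_semicont p q (A : 'M[k]_(r, n) -> 'M[k]_(p, q)) a0 :
  (forall i j, regular (fun a => A a i j)) ->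
  exists2 g, regular g & g a0 != 0 /\
    forall a, g a != 0 -> (\rank (A a0) <= \rank (A a))%N.
Proof.
move=> HA.
have /row_fullP[L HL] : row_full (col_base (A a0)) by apply: col_base_full.
have /row_freeP[M HM] : row_free (row_base (A a0)) by apply: row_base_free.
exists (fun a => \det (L *m A a *m M)).
  apply: regular_det; apply: regular_mulmx; last first.
    by move=> *; apply: regular_const.
  by apply: regular_mulmx => // *; apply: regular_const.
split=> [|a].
  rewrite -[X in L *m X](mulmx_base (A a0)) mulmxA HL mul1mx HM det1.
  exact: oner_neq0.
rewrite -unitfE -unitmxE -row_free_unit => /eqP rk.
rewrite -[leqLHS]rk; apply: leq_trans (mxrankM_maxl _ _) _.
exact: mxrankM_maxr.
Qed.

Definition regular_mpoly q (p : 'M[k]_(r, n) -> {mpoly k[q]}) :=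
  forall m, regular (fun a => (p a)@_m).

Lemma regular_mpolyM q (p1 p2 : 'M[k]_(r, n) -> {mpoly k[q]}) :
  regular_mpoly p1 -> regular_mpoly p2 -> regular_mpoly (fun a => p1 a * p2 a).
Proof.
move=> H1 H2 m; have [f Ef] : regular (fun a =>
    \sum_(l : 'X_{1..q < (mdeg m).+1, (mdeg m).+1} | m == (l.1 + l.2)%MM)
      (p1 a)@_l.1 * (p2 a)@_l.2).
  by apply: regular_sum => l; apply: regularM.
by exists f => a; rewrite mcoeffM Ef.
Qed.

Lemma regular_mpoly_const q (p : {mpoly k[q]}) : regular_mpoly (fun=> p).
Proof. by move=> m; apply: regular_const. Qed.

Lemma regular_mpolyX q (p : 'M[k]_(r, n) -> {mpoly k[q]}) e :
  regular_mpoly p -> regular_mpoly (fun a => p a ^+ e).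
Proof.
move=> Hp; elim: e => [|e IH] m.
  by have [f Ef] := regular_mpoly_const 1 m; exists f.
have [f Ef] := regular_mpolyM Hp IH m.
by exists f => a; rewrite exprS.
Qed.

End Regular.

Lemma regular_powmx (k : fieldType) q (e : 'I_q -> nat) i x y :
  regular (fun a : 'M[k]_(q, 3) => powmx a e i x y).
Proof.
have H : regular_mpoly (fun a : 'M[k]_(q, 3) => generator a (enum_val x)).
  apply: regular_mpolyM; last exact: regular_mpoly_const.
  apply: regular_mpolyX => m.
  have [f Ef] : regular (fun a : 'M[k]_(q, 3) =>
      \sum_j a (tag (enum_val x)) j * 'X_[k, U_(j)]@_m).
    by apply: regular_sum => j; apply: regularM;
      [apply: regular_entry | apply: regular_const].
  exists f => a; rewrite -Ef raddf_sum; apply: eq_bigr => j _ /=.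
  by rewrite mcoeffZ.
by have [f Ef] := H (mon y); exists f => a; rewrite -Ef !mxE.
Qed.

(** * Graded pieces of the quotient by the power ideal *)

Lemma pihomogM_lt (R : idomainType) n (U G : {mpoly R[n]}) u i :
  U \is u.-homog -> (i < u)%N -> pihomog mdeg i (U * G) = 0.
Proof.
move=> Uh iu; rewrite [G]mpolyE mulr_sumr linear_sum big1 // => m _ /=.
rewrite -scalerAr linearZ /=.
have Xh : U * 'X_[m] \is (u + mdeg m).-homog.
  by apply: dhomogM; rewrite ?dhomogX.
rewrite (pihomog_ne0 _ Xh) ?scaler0 //.
by apply: contraTneq iu => <-; rewrite -leqNgt leq_addr.
Qed.

Section Quotient.
Variables (k : fieldType) (q : nat) (a : 'M[k]_(q, 3)) (d : nat).
Implicit Types (p h : {mpoly k[3]}).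

Local Notation I := (power_ideal a d).
Local Notation A i := (powmx a (fun=> d) i).
Local Notation N i := 'C(i + 2, 2).

Lemma in_idealD p h : I p -> I h -> I (p + h).
Proof.
move=> [c ->] [e ->]; exists (fun j => c j + e j); rewrite -big_split.
by apply: eq_bigr => j _; rewrite mulrDl.
Qed.

Lemma in_idealM p h : I p -> I (h * p).
Proof.
move=> [c ->]; exists (fun j => h * c j); rewrite mulr_sumr.
by apply: eq_bigr => j _; rewrite mulrA.
Qed.

Lemma in_ideal0 : I 0.
Proof. by exists (fun=> 0); rewrite big1 // => j _; rewrite mul0r. Qed.

Lemma in_idealZ c p : I p -> I (c *: p).
Proof. by move=> Ip; rewrite -mul_mpolyC; apply: in_idealM. Qed.

Lemma in_ideal_sum (T : Type) (s : seq T) (F : T -> {mpoly k[3]}) :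
  (forall x, I (F x)) -> I (\sum_(x <- s) F x).
Proof.
move=> HF; apply: big_ind => [|p h|x _]; [exact: in_ideal0| |exact: HF].
exact: in_idealD.
Qed.

Lemma in_ideal_lform j h : I (lform (a j) ^+ d * h).
Proof.
exists (fun l => if l == j then h else 0); rewrite (bigD1 j) //= eqxx.
rewrite big1 ?addr0 ?[h * _]mulrC // => l /negPf ->; exact: mul0r.
Qed.

(** Taking degree i components in a representation of p makes the coefficients forms of degree i -
    d, that is, combinations of the monomials indexing the rows. *)
Lemma in_idealP i p : p \is i.-homog -> I p <-> (coords i p <= A i)%MS.
Proof.
move=> ph; split=> [[c Ep]|/submxP[u Eu]].
  have -> : p = \sum_j pihomog mdeg i (lform (a j) ^+ d * c j).
    rewrite -[LHS](pihomog_dE ph) Ep linear_sum; apply: eq_bigr => j _ /=.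
    by rewrite mulrC.
  rewrite linear_sum; apply: summx_sub => j _ /=.
  have lh : lform (a j) ^+ d \is d.-homog.
    by have := dhomogMn d (homog_lform (a j)); rewrite mul1n.
  have [di|id] := leqP d i; last first.
    by rewrite (pihomogM_lt _ lh) // linear0 sub0mx.
  rewrite -[i in pihomog _ i](subnKC di) (pihomogM _ _ lh).
  have /homog_sumX -> := pihomogP mdeg (i - d) (c j).
  rewrite mulr_sumr linear_sum; apply: summx_sub => l _ /=.
  rewrite -scalerAr linearZ; apply: scalemx_sub.
  pose r : gen_index (fun _ : 'I_q => d) i :=
    existT (fun=> 'I_('C(i - d + 2, 2))) j l.
  rewrite (eq_row_sub (enum_rank r)) // rowK enum_rankK.
  by congr (coords _ (_ * 'X_[_])).
rewrite -(coordsK ph) Eu mulmx_sum_row linear_sum; apply: in_ideal_sum => r.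
rewrite linearZ /=; apply: in_idealZ; rewrite rowK; set g := enum_val r.
have [dg|dg] := leqP d i.
  rewrite coordsK; first exact: in_ideal_lform.
  by have := homog_generator a g; rewrite subnKC.
suff -> : coords i (generator a g) = 0 by rewrite linear0; apply: in_ideal0.
apply/rowP => j; rewrite !mxE; apply/eqP; apply: contraTT dg => gj.
have /homog_mdegP/(_ _ gj) := homog_generator a g.
by rewrite mdeg_mon -leqNgt => ->; apply: leq_addr.
Qed.

Lemma quotient_dim_rank i : quotient_dim I i (N i - \rank (A i)).
Proof.
rewrite -mxrank_compl; pose B := row_base (A i)^C%MS.
exists (fun j => polyform (row j B)); split=> [j|p ph].
  exact: polyform_homog.
have E (c : 'rV[k]_(\rank (A i)^C%MS)) :
    I (p - \sum_j c ord0 j *: polyform (row j B)) <->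
    (coords i p - c *m B <= A i)%MS.
  have -> : \sum_j c ord0 j *: polyform (row j B) = polyform (c *m B).
    rewrite mulmx_sum_row linear_sum; apply: eq_bigr => j _.
    by rewrite linearZ.
  have H : p - polyform (c *m B) \is i.-homog.
    by rewrite rpredB // polyform_homog.
  by rewrite (in_idealP H) linearB /= coords_polyform.
have : (coords i p <= A i + (A i)^C)%MS by apply/submx_full/addsmx_compl_full.
case/sub_addsmxP=> -[u v] /= Ep.
have : (v *m (A i)^C%MS <= B)%MS by rewrite eq_row_base submxMl.
case/submxP=> c Ec; exists c; split=> [|c' /E Ic'].
  by apply/E; rewrite Ep Ec addrK submxMl.
apply/eqP; rewrite -subr_eq0; apply/eqP.
apply: (row_free_inj (row_base_free (A i)^C%MS)); rewrite mul0mx.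
apply/eqP; rewrite -submx0 -(capmx_compl (A i)) sub_capmx mulmxBl.
apply/andP; split; last first.
  by rewrite -mulmxBl -(eq_row_base (A i)^C%MS) submxMl.
have -> : c *m B - c' *m B = (coords i p - c' *m B) - u *m A i.
  by rewrite Ep Ec addrAC [u *m _ + _]addrC addrK.
by rewrite addmx_sub // eqmx_opp submxMl.
Qed.

Lemma in_ideal_top i : \rank (A i) = N i ->
  forall e p, (i <= e)%N -> p \is e.-homog -> I p.
Proof.
move=> full e p ie ph.
have Ai h : h \is i.-homog -> I h.
  by move=> hh; apply/(in_idealP hh); apply: submx_full; rewrite /row_full full.
elim: e p ie ph => [|e IH] p.
  by rewrite leqn0 => /eqP i0 ph; apply: Ai; rewrite i0.
rewrite leq_eqVlt => /orP[/eqP <-|]; first exact: Ai.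
rewrite ltnS => ie ph; rewrite [p]mpolyE big_seq.
apply: big_ind => [|p1 p2|m mp]; [exact: in_ideal0 | exact: in_idealD |].
apply: in_idealZ; have me : mdeg m = e.+1.
  by move/homog_mdegP: ph; apply; rewrite -mcoeff_msupp.
have [j mj] : exists j, m j != 0%N.
  apply/existsP; rewrite -[X in is_true X]negbK negb_exists.
  apply/negP => /forallP m0.
  move: me; rewrite mdegE big1 // => j _; apply/eqP.
  by have := m0 j; rewrite negbK.
have Em : m = (U_(j) + (m - U_(j)))%MM by rewrite addmC submK // lep1mP.
rewrite Em mpolyXD; apply: in_idealM; apply: IH => //.
by rewrite dhomogX /=; move: me; rewrite {1}Em mdegD mdeg1 add1n => -[->].
Qed.

End Quotient.

(** * Lower bound for arbitrary points *)

Section LowerBound.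
Variable k : fieldType.
Hypothesis k0 : [pchar k] =i pred0.
Variable a : 'M[k]_(8, 3).
Implicit Types F G : {mpoly k[3]}.

Lemma powmx_eq0 e i : (i < e)%N -> powmx a (fun=> e) i = 0.
Proof.
move=> ie; apply/row_matrixP => r; rewrite rowK row0; apply/rowP => j.
rewrite !mxE; apply/eqP; apply: contraTT ie => gj.
have /homog_mdegP/(_ _ gj) := homog_generator a (enum_val r).
by rewrite mdeg_mon -leqNgt => ->; apply: leq_addr.
Qed.

Lemma rank_powmx_cond i m : (m <= i.+1)%N ->
  (\rank (powmx a (fun=> i.+1 - m) i) <= 8 * 'C(m + 1, 2))%N.
Proof.
(* For m = 0 the exponent i + 1 exceeds the degree and the matrix is zero, whereas counting its rows
   would give one condition per point. *)
case: m => [|m] mi; first by rewrite powmx_eq0 ?mxrank0 // subn0.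
apply: leq_trans (rank_powmx_le _ _ _) _; rewrite sum_nat_const card_ord.
by rewrite (_ : i - (i.+1 - m.+1) + 2 = m.+1 + 1)%N //; lia.
Qed.

Definition mults i (m : 'I_8 -> nat) F := F \is i.-homog /\
  forall j, mult (a j) i (m j) F.

Lemma mults_fat i m F : mults i m F <-> fat a (fun j => i.+1 - m j)%N i F.
Proof. by []. Qed.

Lemma multsM i1 i2 m1 m2 F1 F2 : mults i1 m1 F1 -> mults i2 m2 F2 ->
  mults (i1 + i2) (fun j => m1 j + m2 j)%N (F1 * F2).
Proof.
move=> [h1 H1] [h2 H2]; split=> [|j]; first exact: dhomogM.
by apply: multM => //.
Qed.

Lemma mults1 : mults 0 (fun=> 0%N) 1.
Proof. by split=> [|j]; [apply: dhomog1 | apply/mult0/dhomog1]. Qed.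

Lemma mults_prod (I : Type) (s : seq I) (i : I -> nat) (m : I -> 'I_8 -> nat)
    (F : I -> {mpoly k[3]}) : (forall l, mults (i l) (m l) (F l)) ->
  mults (\sum_(l <- s) i l) (fun j => \sum_(l <- s) m l j)%N
    (\prod_(l <- s) F l).
Proof.
move=> HF; elim: s => [|l s IH].
  rewrite !big_nil; split=> [|j]; first exact: dhomog1.
  by rewrite big_nil; apply: mults1.2.
have [h H] := multsM (HF l) IH; rewrite !big_cons; split=> // j.
by rewrite big_cons; apply: H.
Qed.

(* There are 28 sextics, and a triple point and seven double points impose
   at most 6 + 7 * 3 = 27 conditions. *)
Lemma exists_sextic (l : 'I_8) : exists2 F, F != 0 &
  mults 6 (fun j => if j == l then 3 else 2) F.
Proof.
pose e (j : 'I_8) := (7 - (if j == l then 3 else 2))%N.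
have [F [LF free]] := exists_fat_family k0 a e 6.
have rk : (\rank (powmx a e 6) <= 27)%N.
  apply: leq_trans (rank_powmx_le _ _ _) _; rewrite (bigD1 l) //= /e eqxx.
  rewrite (eq_bigr (fun=> 3%N)) => [|j /negPf ->] //.
  by rewrite sum_nat_const cardC1 card_ord.
have lt : (0 < 'C(6 + 2, 2) - \rank (powmx a e 6))%N.
  by rewrite subn_gt0; apply: leq_ltn_trans rk _.
pose l0 := Ordinal lt; exists (F l0); last by apply/mults_fat; apply: LF.
apply/eqP => F0; have := free (delta_mx 0 l0).
rewrite (bigD1 l0) //= F0 scaler0.
rewrite add0r big1 => [|j jl]; last by rewrite mxE eqxx (negPf jl) scale0r.
move=> /(_ erefl)/matrixP/(_ 0 l0); rewrite !mxE !eqxx => /eqP.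
by rewrite oner_eq0.
Qed.

(** Each point is triple on one sextic and double on seven, and 3 + 7 * 2 = 17. These sextics are
    the Bertini images of the exceptional curves. *)
Lemma exists_sextics e : exists2 F, F != 0 & mults (48 * e) (fun=> 17 * e)%N F.
Proof.
have /fin_all_exists2[Z Z0 HZ] := exists_sextic.
exists ((\prod_j Z j) ^+ e).
  by rewrite expf_neq0 //; apply/prodf_neq0.
have [h H] := mults_prod (index_enum 'I_8) HZ.
have E6 : (\sum_(l < 8) 6 = 48)%N by rewrite sum_nat_const card_ord.
have E17 (j : 'I_8) : (\sum_(l < 8) (if j == l then 3 else 2) = 17)%N.
  rewrite (bigD1 j) //= eqxx (eq_bigr (fun=> 2%N)) => [|l].
    by rewrite sum_nat_const cardC1 card_ord.
  by rewrite eq_sym => /negPf ->.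
rewrite E6 in h; split=> [|j]; first exact: dhomogMn.
have := H j; rewrite E6 E17 => Hj; exact: multX.
Qed.

Lemma rank_powmx_general i m : (m <= i.+1)%N -> (48 * m <= 17 * i)%N ->
  (\rank (powmx a (fun=> i.+1 - m) i) +
    ('C(17 * i - 48 * m + 2, 2) - 8 * 'C((6 * i - 17 * m) + 1, 2)) <=
   'C(i + 2, 2))%N.
Proof.
move=> mi im; have [le|lt] := leqP (17 * m) (6 * i).
  have := rank_leq_col (powmx a (fun=> i.+1 - m)%N i).
  have := rank_powmx_cond mi; have := bertini_euler im le.
  by move: (\rank _) => R; lia.
(* The class decomposes as (i; m) = n (17; 6) + e (48; 17), because 17 * 17 - 6 * 48 = 1; the second
   summand is the product of the sextics. *)
pose n := (17 * i - 48 * m)%N; pose e := (17 * m - 6 * i)%N.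
have -> : (6 * i - 17 * m = 0)%N by lia.
rewrite [X in (_ - 8 * X)%N](_ : _ = 0)%N // muln0 subn0.
have [Z Z0 HZ] := exists_sextics e.
pose u := ((17 * n).+1 - 6 * n)%N.
have [F [LF free]] := exists_fat_family k0 a (fun=> u) (17 * n).
have un : (6 * n <= (17 * n).+1)%N by lia.
have rk := rank_powmx_cond un.
have Ei : (17 * n + 48 * e = i)%N by rewrite /n /e; lia.
have Em : (6 * n + 17 * e = m)%N by rewrite /n /e; lia.
have LG l : fat a (fun=> i.+1 - m)%N i (F l * Z).
  apply/(mults_fat i (fun=> m)); rewrite -Ei -Em.
  exact: (multsM (m1 := fun=> (6 * n)%N) (LF l) HZ).
have := rank_powmx_upper k0 LG; set r := (_ - _)%N => Hr.
have {}Hr : (\rank (powmx a (fun=> i.+1 - m) i) + r <= 'C(i + 2, 2))%N.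
  apply: Hr => c cFZ; apply: free; apply: (mulIf Z0).
  by rewrite mul0r mulr_suml -[RHS]cFZ; apply: eq_bigr => j _; rewrite scalerAl.
(* The count rests on the identity C(17 n + 2, 2) - 8 C(6 n + 1, 2) = C(n + 2, 2). *)
apply: leq_trans Hr; rewrite leq_add2l /r.
move: rk; rewrite -/u -/n; move: (\rank _) => R rk.
have := bin2_mul2 (17 * n + 1); have := bin2_mul2 (6 * n).
have := bin2_mul2 (n + 1); move: rk; rewrite !(addn1, addn2).
move: 'C(_, _) 'C(_, _) 'C(_, _) => A B C; nia.
Qed.

End LowerBound.

(** * The truncated series *)

(** Multiplication of a power series by 1 - X, on coefficient sequences. *)
Definition bdiff (c : nat -> int) (e : nat) : int :=
  if e is e'.+1 then c e - c e' else c 0%N.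

Lemma coef_bdiff M (c : nat -> int) e : (e < M)%N ->
  ((1 - 'X) * \poly_(i < M) c i)`_e = bdiff c e.
Proof.
move=> eM; rewrite mulrBl mul1r coefB coefXM !coef_poly eM.
by case: e eM => [|e] eM /=; rewrite ?subr0 // (ltnW eM).
Qed.

Lemma coef_bdiff_poly M (c : nat -> int) (p : {poly int}) e : (e < M)%N ->
  (forall i, (i < M)%N -> p`_i = c i) -> ((1 - 'X) * p)`_e = bdiff c e.
Proof.
move=> eM pc; rewrite mulrBl mul1r coefB coefXM pc //.
by case: e eM => [|e] eM /=; rewrite ?subr0 // pc // ltnW.
Qed.

Lemma coef_bdiff3 M (c : nat -> int) e : (e < M)%N ->
  ((1 - 'X) ^+ 3 * \poly_(i < M) c i)`_e = bdiff (bdiff (bdiff c)) e.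
Proof.
move=> eM; rewrite exprS expr2 -!mulrA; apply: (coef_bdiff_poly eM) => i iM.
apply: (coef_bdiff_poly iM) => j jM; exact: coef_bdiff.
Qed.

(** A series is determined modulo X^M by its product with (1 - X)^3, because this factor is prime to
    X. *)
Lemma quotient_series_cubeE (p : {poly int}) (c : nat -> int) M :
  (forall e, (e < M)%N -> bdiff (bdiff (bdiff c)) e = p`_e) ->
  forall e, (e < M)%N -> quotient_series p ((1 - 'X) ^+ 3) e = c e.
Proof.
move=> H; pose q : {poly int} := (1 - 'X) ^+ 3.
have q0 : q`_0 = 1.
  by rewrite -horner_coef0 /q !hornerE ?expr1n.
pose s := \poly_(i < M) quotient_series p q i.
have Xq : ~ divides 'X q by move=> /dividesX; rewrite q0.
have : divides 'X^M (q * (\poly_(i < M) c i - s)).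
  apply/dividesXn => e eM; rewrite mulrBr coefB coef_bdiff3 // H //.
  rewrite {1}(quotient_remP p M q0) coefD coefXnM eM addr0.
  exact: subrr.
move=> /(prime_expl (@primeX _) Xq)/dividesXn cs e eM.
have := cs e eM; rewrite coefB !coef_poly eM => /eqP.
by rewrite subr_eq0 => /eqP.
Qed.

(** Coefficients of (1 - 8 X^D) / (1 - X)^3, which agree with those of the series in question below
    degree 2 D. *)
Definition power_coef (D e : nat) : int :=
  'C(e + 2, 2)%:Z - 8 * (if (D <= e)%N then 'C(e - D + 2, 2) else 0)%:Z.

Lemma bdiff_power_coef D e : (0 < D)%N ->
  bdiff (bdiff (bdiff (power_coef D))) e = (e == 0%N)%:Z - 8 * (e == D)%:Z.
Proof.
move=> D0.
have b1 f : bdiff (power_coef D) f =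
    (f.+1)%:Z - 8 * (if (D <= f)%N then (f - D).+1 else 0%N)%:Z.
  case: f => [|f]; rewrite /bdiff /power_coef.
    by rewrite leqn0 (gtn_eqF D0).
  have := bin2_mul2 (f + 1); have := bin2_mul2 (f + 2).
  rewrite !(addn1, addn2); have [Df|Df] := leqP D f.
    rewrite (leq_trans Df) //.
    have := bin2_mul2 (f - D + 1); have := bin2_mul2 (f - D + 2).
    rewrite !(addn1, addn2) subSn //.
    move: 'C(_, _) 'C(_, _) 'C(_, _) 'C(_, _) => A B C E; nia.
  have [Df2|Df2] := leqP D f.+1.
    have -> : (f.+1 - D = 0)%N by lia.
    rewrite (_ : 'C(0.+2, 2) = 1)%N //.
    move: 'C(_, _) 'C(_, _) => A B; nia.
  move: 'C(_, _) 'C(_, _) => A B; nia.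
have b2 f : bdiff (bdiff (power_coef D)) f = 1 - 8 * (D <= f)%:Z.
  case: f => [|f].
    by rewrite /bdiff -/(bdiff (power_coef D) 0) b1 leqn0 (gtn_eqF D0).
  rewrite {1}/bdiff !b1; do 2! case: leqP => ?; lia.
case: e => [|e].
  by rewrite {1}/bdiff b2 leqn0 (gtn_eqF D0) eq_sym (gtn_eqF D0).
rewrite {1}/bdiff !b2 /=; do 2! case: leqP => ?; case: eqP => ?; lia.
Qed.

Lemma coef_power8 D e : (e < 2 * D)%N ->
  ((1 - 'X^D) ^+ 8 : {poly int})`_e = (e == 0%N)%:Z - 8 * (e == D)%:Z.
Proof.
move=> eD; set y : {poly int} := 'X^D.
have -> : (1 - y) ^+ 8 = 1 - y *+ 8 + y ^+ 2 *
    (28%:R - y * 56%:R + y ^+ 2 * 70%:R - y ^+ 3 * 56%:R + y ^+ 4 * 28%:R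
      - y ^+ 5 * 8%:R + y ^+ 6) by ring.
rewrite /y -exprM mulnC coefD coefXnM eD addr0 coefB coef1 coefMn coefXn.
by do 2! case: eqP => _.
Qed.

Lemma quotient_series_power8 D e : (0 < D)%N -> (e < 2 * D)%N ->
  quotient_series ((1 - 'X^D) ^+ 8) ((1 - 'X) ^+ 3) e = power_coef D e.
Proof.
move=> D0 eD; apply: (quotient_series_cubeE (M := (2 * D)%N)) => // f fD.
by rewrite bdiff_power_coef // coef_power8.
Qed.

(** The inequality fails for large e, because 8 * 17^2 > 48^2. For e < 31 one has n <= 10, and
    eleven cases remain. *)
Lemma power_coef_gt0 n e : (e < 31)%N -> (48 * n <= 17 * e)%N ->
  (8 * 'C(n + 1, 2) < 'C(e + 2, 2))%N.
Proof.
move=> e31 ne; have := bin2_mul2 n; have := bin2_mul2 (e + 1).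
rewrite !(addn1, addn2); move: 'C(_, _) 'C(_, _) => A B HA HB.
suff : (8 * (n.+1 * n) < e.+2 * e.+1)%N by lia.
have n10 : (n < 11)%N by lia.
by move: n10 ne {HB HA}; do 11! (case: n => [|n]; first by nia).
Qed.

Section TruncatedSeries.
Variables d d0 d1 : nat.
Hypotheses (hd : (1 <= d)%N) (hd01 : (48 * (d - 1) = 31 * d0 + d1)%N)
  (hd1 : (d1 < 31)%N).

Local Notation D := (1 + 31 * (d - 1) - 20 * d0)%N.
Local Notation m := (17 * (d - 1) - 11 * d0)%N.

Lemma truncatedE :
  truncated (quotient_series ((1 - 'X^D) ^+ 8) ((1 - 'X) ^+ 3)) d1 =
  ('C(d1 + 2, 2) - 8 * 'C(m + 1, 2))%N%:Z /\
  (8 * 'C(m + 1, 2) < 'C(d1 + 2, 2))%N.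
Proof.
have D0 : (0 < D)%N by lia.
have m48 : (48 * m <= 17 * d1)%N by lia.
(* If m is not truncated, D = d1 + 1 - m, so lowering the degree from d1 to e lowers the
   multiplicity from m by the same amount, down to 0 when e < D. *)
have E e : (e <= d1)%N -> power_coef D e =
    'C(e + 2, 2)%:Z - 8 * 'C((m - (d1 - e)) + 1, 2)%:Z.
  move=> ed; rewrite /power_coef; case: leqP => De.
    by rewrite (_ : e - D + 2 = m - (d1 - e) + 1)%N //; lia.
  by rewrite (_ : m - (d1 - e) = 0)%N //; lia.
have pos e : (e <= d1)%N -> (8 * 'C((m - (d1 - e)) + 1, 2) < 'C(e + 2, 2))%N.
  by move=> ed; apply: power_coef_gt0; lia.
have lt : (d1 < 2 * D)%N by lia.
have := pos d1 (leqnn _); rewrite subnn subn0 => pos1; split=> //.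
rewrite /truncated; case: ifP => [_|/negP[]].
  rewrite quotient_series_power8 // E // subnn subn0; lia.
apply/forallP => -[e /= ed]; rewrite quotient_series_power8 //; last by lia.
rewrite E //; have := pos e ed; lia.
Qed.

End TruncatedSeries.

(** * Hilbert series *)

Section SpecialPosition.
Variable k : fieldType.
Hypothesis k0 : [pchar k] =i pred0.

Definition cusp_points : 'M[k]_(8, 3) :=
  \matrix_(j, l) pt ((config 0)`_j)%:~R l.

Lemma fat_cusp_points d i F : (d <= i.+1)%N ->
  fat cusp_points (fun=> d) i F -> usys (cfg k 0) i (i.+1 - d) F.
Proof.
move=> di [Fh Fd]; split=> // _ /mapP[z zc ->].
have lt : (index z (config 0) < 8)%N.
  by rewrite -[8%N]/(size (config 0)) index_mem.
rewrite /mult subKn // -[RHS](Fd (Ordinal lt)); apply: eq_iter => G.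
apply: eq_bigr => l _; congr (_ *: _).
by rewrite mxE /= nth_index.
Qed.

Lemma rank_cusp_points_top d i : (d <= i.+1)%N -> (0 < i)%N ->
  (17 * i < 48 * (i.+1 - d))%N ->
  \rank (powmx cusp_points (fun=> d) i) = 'C(i + 2, 2).
Proof.
move=> di i0 lt; apply/eqP; rewrite eqn_leq rank_leq_col /=.
rewrite -[leqRHS]addn0; apply: rank_powmx_lower => //.
by apply: dimle0 => F LF; apply: (usys_cfg_eq0 k0 i0 lt); apply: fat_cusp_points.
Qed.

Lemma rank_cusp_points d i : (d <= i.+1)%N -> (48 * (i.+1 - d) <= 17 * i)%N ->
  ('C(i + 2, 2) <= \rank (powmx cusp_points (fun=> d) i) +
    ('C(17 * i - 48 * (i.+1 - d) + 2, 2)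
      - 8 * 'C((6 * i - 17 * (i.+1 - d)) + 1, 2)))%N.
Proof.
move=> di le; apply: rank_powmx_lower => //.
apply: (dimle_sub (L' := usys (cfg k 0) i (i.+1 - d))) => [F|].
  exact: fat_cusp_points.
exact: dimle_usys_cfg.
Qed.

End SpecialPosition.

Lemma for_general_regular (k : fieldType) r n (P : 'M[k]_(r, n) -> Prop) g a0 :
  regular g -> g a0 != 0 -> (forall a, g a != 0 -> P a) -> for_general P.
Proof.
move=> [f Ef] ga0 HP; exists (fun a => g a != 0); split=> //; last by exists a0.
exists (eq f) => a; rewrite Ef; split=> [fa|[_ <- //]].
by exists f.
Qed.

Lemma hilbert_series_top (k : fieldType) q (a : 'M[k]_(q, 3)) d t :
  (\rank (powmx a (fun=> d) t) < 'C(t + 2, 2))%N ->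
  \rank (powmx a (fun=> d) t.+1) = 'C(t.+1 + 2, 2) ->
  exists H : {poly int}, [/\ is_hilbert_series (power_ideal a d) H,
    size H = t.+1 &
    lead_coef H = ('C(t + 2, 2) - \rank (powmx a (fun=> d) t))%N%:Z].
Proof.
move=> lt full; pose h i := ('C(i + 2, 2) - \rank (powmx a (fun=> d) i))%N.
have ht : (h t)%:Z != 0 by rewrite -lt0n subn_gt0.
pose H := \poly_(i < t.+1) (h i)%:Z.
have sH : size H = t.+1 by rewrite size_poly_eq.
exists H; split=> // [i|]; last by rewrite /lead_coef sH coef_poly ltnSn.
have [it|ti] := leqP i t.
  by exists (h i); rewrite ?coef_poly ?ltnS ?it //; apply: quotient_dim_rank.
exists 0%N; last by rewrite coef_poly ltnNge ti.
exists (fun=> 0); split=> [[] //|p ph]; exists 0; split=> [|c _]; last first.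
  by apply/rowP => -[].
by rewrite big_ord0 subr0; apply: (in_ideal_top full ti).
Qed.

Theorem proposition8p3 (k : fieldType) (hk : [pchar k] =i pred0)
    (d d0 d1 : nat) (hd : (1 <= d)%N)
    (hd01 : (48 * (d - 1) = 31 * d0 + d1)%N) (hd1 : (d1 < 31)%N) :
  let c := truncated
    (quotient_series ((1 - 'X^(1 + 31 * (d - 1) - 20 * d0)) ^+ 8)
                     ((1 - 'X) ^+ 3)) in
  [/\ for_general (fun a : 'M[k]_(8, 3) =>
        exists H : {poly int},
          [/\ is_hilbert_series (power_ideal a d) H,
              size H = d0.+1 & lead_coef H = c d1]),
      (17 * d1 <= d0)%N -> c d1 = 'C(d1 + 2, 2)%:Z &
      (300 < d)%N -> (17 * d1 <= d0)%N].
Proof.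
have [Ec cpos] := truncatedE hd hd01 hd1.
(* The solutions are d - 1 = 11 d1 + 31 j and d0 = 17 d1 + 48 j with j an integer. From d > 300 and
   d1 <= 30 follows 31 j >= -30, so j >= 0. *)
move=> c; rewrite -/(c d1) in Ec; split; last by lia.
- pose h := ('C(d1 + 2, 2) - 8 * 'C(17 * (d - 1) - 11 * d0 + 1, 2))%N.
  have dd0 : (d <= d0.+1)%N by lia.
  have E1 : (17 * d0 - 48 * (d0.+1 - d) = d1)%N by lia.
  have E2 : (6 * d0 - 17 * (d0.+1 - d) = 17 * (d - 1) - 11 * d0)%N by lia.
  have le48 : (48 * (d0.+1 - d) <= 17 * d0)%N by lia.
  have ent i : forall x y, regular (fun a : 'M[k]_(8, 3) =>
      powmx a (fun=> d) i x y) by move=> x y; apply: regular_powmx.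
  (* Two open conditions are needed: the rank in degree d0 is at least that at the special points,
     and in degree d0 + 1 it is full. *)
  have [g1 rg1 [g1n H1]] := rank_lower_semicont (cusp_points k) (ent d0).
  have [g2 rg2 [g2n H2]] := rank_lower_semicont (cusp_points k) (ent d0.+1).
  apply: (for_general_regular (g := fun a => g1 a * g2 a) (a0 := cusp_points k)).
  + exact: regularM.
  + by rewrite mulf_neq0.
  move=> a; rewrite mulf_eq0 negb_or => /andP[/H1 r1 /H2 r2].
  have low := rank_cusp_points hk dd0 le48.
  have up : (\rank (powmx a (fun=> d) d0) + h <= 'C(d0 + 2, 2))%N.
    have := @rank_powmx_general k hk a d0 (d0.+1 - d) (leq_subr _ _) le48.
    by rewrite subKn // E1 E2.
  rewrite E1 E2 -/h in low.
  have rk : (\rank (powmx a (fun=> d) d0) = 'C(d0 + 2, 2) - h)%N.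
    have := leq_trans low (leq_add r1 (leqnn h)); lia.
  have hpos : (0 < h)%N by rewrite subn_gt0.
  have hle : (h <= 'C(d0 + 2, 2))%N by apply: leq_trans up; apply: leq_addl.
  have [||H [HH sH lH]] := @hilbert_series_top k 8 a d d0.
  + by rewrite rk ltn_subrL hpos; apply: leq_trans hle.
  + apply/eqP; rewrite eqn_leq rank_leq_col /=; apply: leq_trans r2.
    (* The inequality required in degree d0 + 1 amounts to d1 < 31. *)
    by rewrite rank_cusp_points_top //; lia.
  by exists H; split=> //; rewrite lH Ec rk subKn.
(* Without truncation, 48 times this number is 17 d1 - d0. *)
move=> d0d1; rewrite Ec (_ : 17 * (d - 1) - 11 * d0 = 0)%N; last by lia.
by rewrite (_ : 'C(0 + 1, 2) = 0)%N // muln0 subn0.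
Qed.
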